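(* Let $\Lambda$ be an artin algebra and let $\mathcal{C}$ be a functorially finite (full, additive) subcategory of $\mathrm{mod}\,\Lambda$, closed under direct summands and isomorphisms. If any family of morphisms between indecomposable objects in $\mathcal{C}$ is noetherian, then $\mathcal{C}$ is of finite representation type.
   Context: $\mathrm{mod}\,\Lambda$ is the category of finitely generated left $\Lambda$-modules. A left $\mathcal{C}$-approximation of $X\in\mathrm{mod}\,\Lambda$ is a morphism $\alpha:X\to C$ with $C\in\mathcal{C}$ such that every morphism $X\to C'$ with $C'\in\mathcal{C}$ factors through $\alpha$; right $\mathcal{C}$-approximations are dual. $\mathcal{C}$ is functorially finite if every $X\in\mathrm{mod}\,\Lambda$ has both a left and a right $\mathcal{C}$-approximation. $\mathcal{C}$ is of finite representation type if it has finitely many isomorphism classes of indecomposable objects. A family $\{f_j\}_{j\in J}$ of morphisms in $\mathcal{C}$ is noetherian if for any infinite chain $C_0\xrightarrow{f_{j_1}}C_1\xrightarrow{f_{j_2}}C_2\to\cdots$ of morphisms in the family with $f_{j_i}\cdots f_{j_2}f_{j_1}\ne0$ for all $i$, there is $d\ge1$ such that $f_{j_k}$ is an isomorphism for all $k\ge d$. *)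

(* Defs.v *)
From mathcomp Require Import all_boot all_algebra.

Set Implicit Arguments.
Unset Strict Implicit.
Unset Printing Implicit Defensive.

Import GRing.Theory.
Local Open Scope ring_scope.

Definition is_ideal (R : comPzRingType) (I : R -> Prop) : Prop :=
  [/\ I 0, forall x y, I x -> I y -> I (x + y) & forall a x, I x -> I (a * x)].

Definition artinian (R : comPzRingType) : Prop :=
  forall I : nat -> R -> Prop,
    (forall n, is_ideal (I n)) ->
    (forall n x, I n.+1 x -> I n x) ->
    exists n, forall m, (n <= m)%N -> forall x, I n x -> I m x.

(* The R-algebra structure on L is given by a ring morphism phi from R to the
   center of L rather than by [algType R], because the latter excludes the
   zero ring. *)
Definition artin_algebra (R : comPzRingType) (L : pzRingType)
    (phi : {rmorphism R -> L}) : Prop :=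
  [/\ artinian R,
      forall r x, GRing.comm (phi r) x &
      exists n (e : 'I_n -> L),
        forall x, exists c : 'I_n -> R, x = \sum_(i < n) phi (c i) * e i].

Section Modules.
Variable L : pzRingType.

Definition finitely_generated (M : lmodType L) : Prop :=
  exists n (e : 'I_n -> M),
    forall x, exists c : 'I_n -> L, x = \sum_(i < n) c i *: e i.

Definition is_iso (M N : lmodType L) (f : {linear M -> N}) : Prop :=
  exists g : {linear N -> M}, cancel f g /\ cancel g f.

Definition isomorphic (M N : lmodType L) : Prop :=
  exists f : {linear M -> N}, is_iso f.

Definition is_zero_module (M : lmodType L) : Prop := forall x : M, x = 0.

Definition indecomposable (M : lmodType L) : Prop :=
  ~ is_zero_module M /\
  forall X Y : lmodType L, isomorphic M (X * Y)%type ->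
    is_zero_module X \/ is_zero_module Y.

(* A full subcategory is given by the predicate C selecting its objects. *)

Definition subcategory_of_mod (C : lmodType L -> Prop) : Prop :=
  forall M, C M -> finitely_generated M.

Definition iso_closed (C : lmodType L -> Prop) : Prop :=
  forall M N, isomorphic M N -> C M -> C N.

Definition additive_subcategory (C : lmodType L -> Prop) : Prop :=
  (exists2 Z, C Z & is_zero_module Z) /\
  forall M N : lmodType L, C M -> C N -> C (M * N)%type.

Definition summand_closed (C : lmodType L -> Prop) : Prop :=
  forall M X Y : lmodType L, isomorphic M (X * Y)%type -> C M -> C X /\ C Y.

Definition left_approximation (C : lmodType L -> Prop) (X A : lmodType L)
    (alpha : {linear X -> A}) : Prop :=
  C A /\
  forall (B : lmodType L) (g : {linear X -> B}), C B ->
    exists h : {linear A -> B}, g =1 h \o alpha.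

Definition right_approximation (C : lmodType L -> Prop) (X A : lmodType L)
    (alpha : {linear A -> X}) : Prop :=
  C A /\
  forall (B : lmodType L) (g : {linear B -> X}), C B ->
    exists h : {linear B -> A}, g =1 alpha \o h.

Definition functorially_finite (C : lmodType L -> Prop) : Prop :=
  forall X : lmodType L, finitely_generated X ->
    (exists (A : lmodType L) (alpha : {linear X -> A}), left_approximation C alpha) /\
    (exists (A : lmodType L) (alpha : {linear A -> X}), right_approximation C alpha).

Definition finite_representation_type (C : lmodType L -> Prop) : Prop :=
  exists n (X : 'I_n -> lmodType L),
    forall M, C M -> indecomposable M -> exists i, isomorphic M (X i).

Record morphism := Morphism {
  source : lmodType L;
  target : lmodType L;
  arrow : {linear source -> target}
}.

(* The composite of the first n maps of the chain. *)
Fixpoint chain_comp (X : nat -> lmodType L)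
    (g : forall i, {linear X i -> X i.+1}) (n : nat) : X 0%N -> X n :=
  match n with
  | 0 => id
  | m.+1 => g m \o chain_comp g m
  end.

(* A chain of morphisms of the family is a sequence j of indices together with
   objects X i and maps g i : X i -> X i.+1 such that the member of index j i
   is g i; the maps are numbered from 0. *)
Definition noetherian (J : Type) (f : J -> morphism) : Prop :=
  forall (X : nat -> lmodType L) (g : forall i, {linear X i -> X i.+1})
         (j : nat -> J),
    (forall i, f (j i) = Morphism (g i)) ->
    (forall i, ~ (chain_comp g i.+1 =1 fun=> 0)) ->
    exists d, forall k, (d <= k)%N -> is_iso (g k).

Definition between_indecomposables (C : lmodType L -> Prop) (u : morphism) :
    Prop :=
  [/\ C (source u), indecomposable (source u),
      C (target u) & indecomposable (target u)].

End Modules.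

(* Main.v *)
From HB Require Import structures.
Require Import Defs.
From mathcomp Require Import all_boot all_algebra.
From mathcomp Require Import boolp.

(* Suppose infinitely many indecomposables of C are pairwise non-isomorphic.
   Call an element x of an indecomposable X in C big if infinitely many
   isomorphism classes of indecomposables M in C admit a map X -> M with x
   |-> nonzero. The image of 1 under a left C-approximation L -> A has a big
   component in some indecomposable summand of A. If x in X is big, let e : X
   -> E be left almost split and E -> B a left C-approximation: every map X
   -> M with M not isomorphic to X factors through B, so the image of x in
   some indecomposable summand Y of B is again big, and X -> Y is not an
   isomorphism since e does not split. Iterating gives a chain of non-
   isomorphisms with nonzero composites.

   The left almost split map is obtained by duality over R. Let J be the
   minimal injective cogenerator of R and y_1, ..., y_b generators of
   Hom_R(X, J). Presenting them as a right L-module by a matrix A, Hom_R(M^b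
   / A M^a, J) is Hom_L(M, X). Reflexivity yields t in X^b which is killed by
   the functionals coming from rad End(X) but not by the one coming from the
   identity; then t is not in A X^a, whereas h(t) is in A M^a for every h : X
   -> M that is not a split monomorphism. Hence E is the extension of X by
   the equations t = A z.

   The module J is built without injective hulls: call V socle distinct if
   every simple R-module occurs at most once in its socle. If r <> 0 kills
   such a V, then V can be amalgamated with R to a larger one that r does not
   kill, so one with smallest annihilator is faithful; and maps between
   submodules of a socle distinct module are given by scalars, which makes a
   faithful one an injective cogenerator. *)

Set Implicit Arguments.
Unset Strict Implicit.
Unset Printing Implicit Defensive.

Import GRing.Theory.
Local Open Scope ring_scope.

(** * Submodules, chain conditions and quotients *)

Section Submodules.
Variable A : pzRingType.

Definition submod (V : lmodType A) (N : V -> Prop) : Prop :=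
  [/\ N 0, forall x y, N x -> N y -> N (x + y) & forall a x, N x -> N (a *: x)].

Definition incl (T : Type) (M N : T -> Prop) : Prop := forall x, M x -> N x.

Lemma incl_trans (T : Type) (K M N : T -> Prop) :
  incl K M -> incl M N -> incl K N.
Proof. by move=> KM MN x /KM /MN. Qed.

Lemma incl_refl (T : Type) (N : T -> Prop) : incl N N.
Proof. by move=> x. Qed.

Lemma submodN (V : lmodType A) (N : V -> Prop) x : submod N -> N x -> N (- x).
Proof. by case=> _ _ NZ Nx; rewrite -scaleN1r; apply: NZ. Qed.

Lemma submodB (V : lmodType A) (N : V -> Prop) x y :
  submod N -> N x -> N y -> N (x - y).
Proof. by move=> sN Nx Ny; case: (sN) => _ ND _; apply: ND => //; apply: submodN. Qed.

Lemma submod_true (V : lmodType A) : submod (fun _ : V => True).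
Proof. by []. Qed.

Lemma submod_zero (V : lmodType A) : submod (fun x : V => x = 0).
Proof.
by split=> [//|x y -> ->|a x ->]; rewrite ?addr0 ?scaler0.
Qed.

Lemma submodI (V : lmodType A) (M N : V -> Prop) :
  submod M -> submod N -> submod (fun x => M x /\ N x).
Proof.
by case=> M0 MD MZ [N0 ND NZ]; split=> [//|x y [? ?] [? ?]|a x [? ?]]; split; auto.
Qed.

Definition addsm (V : lmodType A) (M N : V -> Prop) (z : V) : Prop :=
  exists x y, [/\ M x, N y & z = x + y].

Lemma submod_add (V : lmodType A) (M N : V -> Prop) :
  submod M -> submod N -> submod (addsm M N).
Proof.
case=> M0 MD MZ [N0 ND NZ]; split=> [|_ _ [x [y [? ? ->]]] [z [t [? ? ->]]]|].
- by exists 0, 0; rewrite addr0.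
- by exists (x + z), (y + t); rewrite addrACA; split; auto.
- by move=> a _ [x [y [? ? ->]]]; exists (a *: x), (a *: y); rewrite scalerDr; split; auto.
Qed.

Definition line (V : lmodType A) (v : V) (x : V) : Prop := exists a, x = a *: v.

Lemma submod_line (V : lmodType A) (v : V) : submod (line v).
Proof.
split=> [|_ _ [a ->] [b ->]|a _ [b ->]]; first by exists 0; rewrite scale0r.
- by exists (a + b); rewrite scalerDl.
- by exists (a * b); rewrite scalerA.
Qed.

Lemma incl_addl (V : lmodType A) (M N : V -> Prop) : submod N -> incl M (addsm M N).
Proof. by case=> N0 _ _ x Mx; exists x, 0; rewrite addr0. Qed.

Lemma incl_addr (V : lmodType A) (M N : V -> Prop) : submod M -> incl N (addsm M N).
Proof. by case=> M0 _ _ x Nx; exists 0, x; rewrite add0r. Qed.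

Lemma line_id (V : lmodType A) (v : V) : line v v.
Proof. by exists 1; rewrite scale1r. Qed.

Lemma submod_ker (V W : lmodType A) (f : {linear V -> W}) :
  submod (fun x => f x = 0).
Proof.
split=> [|x y fx fy|a x fx]; first exact: linear0.
- by rewrite linearD fx fy addr0.
- by rewrite linearZ /= fx scaler0.
Qed.

Definition img (V W : lmodType A) (f : V -> W) (U : V -> Prop) (y : W) : Prop :=
  exists2 x, U x & y = f x.

Lemma submod_img (V W : lmodType A) (f : {linear V -> W}) (U : V -> Prop) :
  submod U -> submod (img f U).
Proof.
case=> U0 UD UZ; split=> [|_ _ [x ? ->] [y ? ->]|a _ [x ? ->]].
- by exists 0; rewrite ?linear0.
- by exists (x + y); rewrite ?linearD; auto.
- by exists (a *: x); rewrite ?linearZ; auto.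
Qed.

Definition ascending (T : Type) (I : nat -> T -> Prop) := forall n, incl (I n) (I n.+1).
Definition descending (T : Type) (I : nat -> T -> Prop) := forall n, incl (I n.+1) (I n).

Lemma ascending_le (T : Type) (I : nat -> T -> Prop) m n :
  ascending I -> (m <= n)%N -> incl (I m) (I n).
Proof.
move=> aI /subnK <-; elim: (n - m)%N => [|k IHk]; first exact: incl_refl.
exact: incl_trans IHk (aI _).
Qed.

Lemma descending_le (T : Type) (I : nat -> T -> Prop) m n :
  descending I -> (m <= n)%N -> incl (I n) (I m).
Proof.
move=> aI /subnK <-; elim: (n - m)%N => [|k IHk]; first exact: incl_refl.
exact: incl_trans (aI _) IHk.
Qed.

Definition dcc (V : lmodType A) : Prop := forall I : nat -> V -> Prop,
  (forall n, submod (I n)) -> descending I ->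
  exists n, forall m, (n <= m)%N -> incl (I n) (I m).

Definition acc_on (V : lmodType A) (U : V -> Prop) : Prop :=
  forall I : nat -> V -> Prop,
  (forall n, submod (I n)) -> (forall n, incl (I n) U) -> ascending I ->
  exists n, forall m, (n <= m)%N -> incl (I m) (I n).

Definition acc (V : lmodType A) : Prop := acc_on (fun _ : V => True).

Lemma dependent_choice (T : Type) (P : T -> Prop) (r : T -> T -> Prop) x0 :
  P x0 -> (forall x, P x -> exists2 y, P y & r x y) ->
  exists s : nat -> T, [/\ s 0%N = x0, forall n, P (s n) & forall n, r (s n) (s n.+1)].
Proof.
move=> Px0 next.
have ex (u : {x | P x}) : exists v : {x | P x}, r (sval u) (sval v).
  by case: u => x Px; have [y Py rxy] := next x Px; exists (exist _ y Py).
have [f fP] := choice ex.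
exists (fun n => sval (iter n f (exist _ x0 Px0))); split=> // n.
exact: svalP.
Qed.

Lemma dcc_min (V : lmodType A) (P : (V -> Prop) -> Prop) :
  dcc V -> (exists2 N, submod N & P N) ->
  exists N, [/\ submod N, P N &
    forall N', submod N' -> P N' -> incl N' N -> incl N N'].
Proof.
move=> dV [N0 sN0 PN0]; apply: contrapT => nmin.
have next (N : V -> Prop) : submod N /\ P N ->
    exists2 N', submod N' /\ P N' & incl N' N /\ ~ incl N N'.
  move=> [sN PN]; apply: contrapT => nex; apply: nmin; exists N; split=> //.
  move=> N' sN' PN' N'N; apply: contrapT => nNN'; apply: nex.
  by exists N'.
have [I [_ IP Inext]] := dependent_choice (conj sN0 PN0) next.
have [n nP] := dV I (fun n => (IP n).1) (fun n => (Inext n).1).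
exact: (Inext n).2 (nP _ (leqnSn n)).
Qed.

Lemma acc_max (V : lmodType A) (P : (V -> Prop) -> Prop) :
  acc V -> (exists2 N, submod N & P N) ->
  exists N, [/\ submod N, P N &
    forall N', submod N' -> P N' -> incl N N' -> incl N' N].
Proof.
move=> aV [N0 sN0 PN0]; apply: contrapT => nmax.
have next (N : V -> Prop) : submod N /\ P N ->
    exists2 N', submod N' /\ P N' & incl N N' /\ ~ incl N' N.
  move=> [sN PN]; apply: contrapT => nex; apply: nmax; exists N; split=> //.
  move=> N' sN' PN' N'N; apply: contrapT => nNN'; apply: nex.
  by exists N'.
have [I [_ IP Inext]] := dependent_choice (conj sN0 PN0) next.
have [n nP] := aV I (fun n => (IP n).1) (fun n x _ => Logic.I) (fun n => (Inext n).1).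
exact: (Inext n).2 (nP _ (leqnSn n)).
Qed.

(** A chain is constant once its kernel part and its image are: if [f x = f y] with [y] in the
    earlier member, then [x - y] lies in the kernel part. *)
Lemma acc_on_ext (V W : lmodType A) (f : {linear V -> W}) (U : V -> Prop) :
  acc_on (fun x => U x /\ f x = 0) -> acc_on (img f U) -> acc_on U.
Proof.
move=> aK aI I sI IU ascI.
have [|||n nP] := aK (fun n x => I n x /\ f x = 0).
- by move=> n; apply: submodI; [apply: sI | apply: submod_ker].
- by move=> n x [/IU].
- by move=> n x [/ascI].
have [|||k kP] := aI (fun n => img f (I n)).
- by move=> i; apply: submod_img.
- by move=> i _ [x /IU Ux ->]; exists x.
- by move=> i _ [x /ascI Ix ->]; exists x.
exists (maxn n k) => m; rewrite geq_max => /andP[nm km] x Ix.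
have [y Iy fxy] := kP m km _ (ex_intro2 _ _ _ Ix erefl).
have Iyl l : (k <= l)%N -> I l y by move=> kl; apply: ascending_le Iy.
have Ixy : I n (x - y) /\ f (x - y) = 0.
  apply: (nP m nm); split; last by rewrite linearB /= fxy subrr.
  by apply: submodB => //; apply: Iyl.
rewrite -(subrK y x); case: (sI (maxn n k)) => _ ID _; apply: ID.
  by apply: (ascending_le ascI (leq_maxl n k)); case: Ixy.
exact: Iyl (leq_maxr n k).
Qed.

Definition fgen (V : lmodType A) (N : V -> Prop) : Prop :=
  exists n (e : 'I_n -> V), (forall i, N (e i)) /\
    forall x, N x -> exists c : 'I_n -> A, x = \sum_i c i *: e i.

(** A maximal finitely generated submodule inside [N] cannot grow by adjoining another [x] of
    [N]. *)
Lemma acc_fgen (V : lmodType A) (N : V -> Prop) : acc V -> submod N -> fgen N.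
Proof.
move=> aV sN.
pose P (M : V -> Prop) := incl M N /\ fgen M.
have [|M [sM [MN [n [e [Me eM]]]] Mmax]] := @acc_max V P aV.
  exists (fun x => x = 0); first exact: submod_zero.
  split=> [x ->|]; first by case: sN.
  by exists 0%N, (fun=> 0); split=> // x ->; exists (fun=> 0); rewrite big_ord0.
exists n, e; split=> [i|x Nx]; first exact/MN/Me.
apply: (eM); pose M' := addsm (line x) M.
have sM' : submod M' by apply: submod_add => //; apply: submod_line.
apply: (Mmax M') => //; last 2 first.
- by apply: incl_addr; apply: submod_line.
- by apply: incl_addl => //; apply: line_id.
split; first by move=> _ [_ [z [[a ->] /MN Nz ->]]]; case: sN => _ ND NZ; apply: ND; auto.
exists n.+1, (fun i => oapp e x (unlift ord0 i)); split=> [i|_ [_ [z [[a ->] /eM[c ->] ->]]]].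
  case: unliftP => /= [j _|_].
    by apply: incl_addr; [apply: submod_line | apply: Me].
  by apply: incl_addl => //; apply: line_id.
exists (fun i => oapp c a (unlift ord0 i)); rewrite big_ord_recl unlift_none; congr (_ + _).
by apply: eq_bigr => i _; rewrite liftK.
Qed.

Definition mklin (V W : lmodType A) (f : V -> W) (lf : linear f) : {linear V -> W} :=
  HB.pack f (GRing.isLinear.Build A V W *:%R f lf).

Lemma mklinE (V W : lmodType A) (f : V -> W) (lf : linear f) : mklin lf =1 f.
Proof. by []. Qed.

(** Quotients enter only as a surjection with prescribed kernel. The action [sc] is computed on
    chosen representatives; stability of [N] under scalars makes the choice harmless. *)
Lemma quotient_exists (V : lmodType A) (N : V -> Prop) : submod N ->
  exists (Q : lmodType A) (p : {linear V -> Q}),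
    (forall q, exists x, q = p x) /\ forall x, p x = 0 <-> N x.
Proof.
move=> sN; case: (sN) => N0 ND NZ.
pose S : {pred V} := fun x => `[< N x >].
have SP x : (x \in S) <-> N x by split=> [/asboolP|Nx] //; apply/asboolP.
have zS : zmod_closed S.
  split=> [|x y /SP Nx /SP Ny]; apply/SP => //; exact: submodB.
pose I : zmodClosed V := HB.pack (S : V -> bool) (GRing.isZmodClosed.Build V S zS).
pose Q := Quotient.quot I.
pose pi : V -> Q := \pi_Q%qT.
have piE (x y : V) : pi x = pi y <-> N (x - y).
  rewrite -SP; have -> : (x - y \in S) = (x - y \in I) by [].
  by rewrite Quotient.idealrBE; split=> [xy|/eqP //]; apply/eqP.
have piK (q : Q) : pi (repr q) = q by exact: reprK.
pose sc (a : A) (q : Q) : Q := pi (a *: repr q).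
have scE a x : sc a (pi x) = pi (a *: x).
  by apply/piE; rewrite -scalerBr; apply: NZ; apply/piE; rewrite piK.
have piD (x y : V) : pi (x + y) = pi x + pi y by exact: raddfD.
have sq (q : Q) : exists x, q = pi x by exists (repr q); rewrite piK.
have scA a b v : sc a (sc b v) = sc (a * b) v.
  by have [x ->] := sq v; rewrite !scE scalerA.
have sc1 : left_id 1 sc by move=> v; have [x ->] := sq v; rewrite scE scale1r.
have scDr : right_distributive sc +%R.
  by move=> a u v; have [x ->] := sq u; have [y ->] := sq v; rewrite -piD !scE -piD scalerDr.
have scDl v : {morph sc^~ v : a b / a + b}.
  by move=> a b; have [x ->] := sq v; rewrite !scE -piD scalerDl.
pose QL : lmodType A := HB.pack Q (GRing.Zmodule_isLmodule.Build A Q scA sc1 scDr scDl).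
have lp : linear (pi : V -> QL).
  by move=> a x y; rewrite [LHS]piD; congr (_ + _); rewrite -scE.
exists QL, (mklin lp); split=> [//|x].
by rewrite mklinE -(raddf0 (\pi_Q : V -> Q)%qT) piE subr0.
Qed.

Lemma linear_descends (V W Q : lmodType A) (p : {linear V -> Q}) (f : {linear V -> W}) :
  (forall q, exists x, q = p x) -> (forall x, p x = 0 -> f x = 0) ->
  exists g : {linear Q -> W}, forall x, g (p x) = f x.
Proof.
move=> /choice[s sP] kp.
have fs x : f (s (p x)) = f x.
  by apply/eqP; rewrite -subr_eq0 -linearB /= kp // linearB /= -sP subrr.
have lf : linear (fun q => f (s q)).
  by move=> a u v; rewrite [u]sP [v]sP -linearP !fs linearP.
by exists (mklin lf) => x; apply: fs.
Qed.

End Submodules.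

(** * Artinian commutative rings *)

Section ArtinianRings.
Variable R : comPzRingType.
Hypothesis artR : artinian R.

Lemma artinian_dcc_regular : dcc R^o.
Proof. by move=> I sI dI; apply: artR => // n; case: (sI n) => I0 ID IZ; split. Qed.

Lemma dcc_fgen (V : lmodType R) : finitely_generated V -> dcc V.
Proof.
case=> n [e eV].
(* Induction on [k], for chains contained in the span of the first [k] generators. *)
suff stab k (I : nat -> V -> Prop) : (forall m, submod (I m)) -> descending I ->
    (forall m x, I m x -> exists c : nat -> R,
       x = \sum_(i < n | (i < k)%N) c i *: e i) ->
    exists d, forall m, (d <= m)%N -> incl (I d) (I m).
  move=> I sI dI; apply: (stab n I sI dI) => m x _.
  have [c ->] := eV x; exists (fun i => if insub i is Some j then c j else 0).
  by apply: eq_big => [i|i _]; rewrite ?ltn_ord // valK.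
elim: k I => [|k IHk] I sI dI Ik.
  exists 0%N => m _ x /Ik[c]; rewrite big_pred0 // => ->.
  by case: (sI m).
have [nk|kn] := leqP n k.
  apply: IHk => // m x /Ik[c ->]; exists c; apply: eq_bigl => i.
  by rewrite !(leq_trans (ltn_ord i)) // ltnW.
pose ek := e (Ordinal kn).
pose S (x : V) := exists c : nat -> R, x = \sum_(i < n | (i < k)%N) c i *: e i.
have sS : submod S.
  split=> [|_ _ [c ->] [c' ->]|a _ [c ->]].
  - by exists (fun=> 0); rewrite big1 // => i _; rewrite scale0r.
  - exists (fun i => c i + c' i); rewrite -big_split /=.
    by apply: eq_bigr => i _; rewrite scalerDl.
  - exists (fun i => a * c i); rewrite scaler_sumr.
    by apply: eq_bigr => i _; rewrite scalerA.
have Ik' m x : I m x -> exists r u, S u /\ x = r *: ek + u.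
  move=> /Ik[c ->]; exists (c k), (\sum_(i < n | (i < k)%N) c i *: e i).
  split; first by exists c.
  rewrite (bigD1 (Ordinal kn)) //=; congr (_ + _); apply: eq_bigl => i.
  by rewrite ltnS -val_eqE /= ltn_neqAle andbC.
have [|||d1 d1P] := IHk (fun m x => I m x /\ S x).
- by move=> m; apply: submodI.
- by move=> m x [/dI].
- by move=> m x [_].
(* The chain is controlled by its intersections with the span [S] of the earlier generators and by
   its ideals of coefficients at [ek]. *)
pose J m (r : R^o) := exists2 u, S u & I m (r *: ek + u).
have [||d2 d2P] := artinian_dcc_regular (I := J).
- move=> m; case: (sI m) (sS) => I0 ID IZ [S0 SD SZ].
  split=> [|r r' [u Su Iu] [u' Su' Iu']|a r [u Su Iu]].
  + by exists 0; rewrite ?scale0r ?addr0.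
  + by exists (u + u'); [exact: SD | rewrite scalerDl addrACA; exact: ID].
  + by exists (a *: u); [exact: SZ | rewrite -scalerA -scalerDr; exact: IZ].
- by move=> m r [u Su /dI]; exists u.
exists (maxn d1 d2) => m; rewrite geq_max => /andP[d1m d2m] x Ix.
have [r [u [Su xE]]] := Ik' _ _ Ix.
have [|u' Su' Iu'] := d2P m d2m r.
  by exists u => //; rewrite -xE; apply: (descending_le dI (leq_maxr _ _)) Ix.
have [|Imx _] := d1P m d1m (x - (r *: ek + u')).
  split; last by rewrite xE opprD addrACA subrr add0r; apply: submodB.
  apply: submodB => //; first exact: (descending_le dI (leq_maxl _ _)) Ix.
  exact: (descending_le dI d1m) Iu'.
by rewrite -(subrK (r *: ek + u') x); case: (sI m) => _ ID _; apply: ID.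
Qed.

Lemma dcc_acc_on_nat (V : lmodType R) (U : V -> Prop) : submod U -> ~ acc_on U ->
  exists (N : nat -> V -> Prop) (v : nat -> V),
    [/\ forall n, submod (N n), ascending N, forall n, incl (N n) U,
        forall n, ~ N n (v n) & forall n, N n.+1 (v n)].
Proof.
move=> sU naU; apply: contrapT => nex; apply: naU => I sI IU aI.
apply: contrapT => nstab.
have next (n : nat) : True -> exists2 m, True & (n < m)%N /\ exists2 x, I m x & ~ I n x.
  move=> _; apply: contrapT => nm; apply: nstab; exists n => m.
  rewrite leq_eqVlt => /predU1P[<-|nltm]; first exact: incl_refl.
  by move=> x Ix; apply: contrapT => nIx; apply: nm; exists m => //; split=> //; exists x.
have [k [_ _ kP]] := @dependent_choice nat (fun=> True) _ 0%N Logic.I next.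
have /choice[v vP] n : exists x, I (k n.+1) x /\ ~ I (k n) x.
  by have [_ [x]] := kP n; exists x.
apply: nex; exists (fun n => I (k n)), v; split=> // n; try by case: (vP n).
by apply: ascending_le => //; apply: ltnW; case: (kP n).
Qed.

(* A minimal submodule U violating ACC is a vector space over the field
   R / Ann U, because each r in R kills U or maps U onto itself. *)
Lemma dcc_acc (V : lmodType R) : dcc V -> acc V.
Proof.
move=> dV; apply: contrapT => naV.
have [|U [sU naU Umin]] := @dcc_min _ V (fun U => ~ acc_on U) dV.
  by exists (fun=> True).
have small U' : submod U' -> incl U' U -> ~ incl U U' -> acc_on U'.
  by move=> sU' U'U nUU'; apply: contrapT => /Umin; auto.
(* Otherwise kernel and image of [r] on [U] are both proper, so they satisfy ACC by minimality, and
   with them [U]. *)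
have alt (r : R) : (forall x, U x -> r *: x = 0) \/ incl U (img ( *:%R r) U).
  apply: contrapT => /not_orP[nk ni]; apply: naU.
  have lr : linear ( *:%R r : V -> V).
    by move=> a x y; rewrite scalerDr !scalerA mulrC.
  apply: (@acc_on_ext _ V V (mklin lr)); apply: small => //.
  - by apply: submodI => //; apply: submod_ker.
  - by move=> x [].
  - by move=> UK; apply: nk => x /UK[].
  - exact: submod_img.
  - by case: sU => _ _ UZ _ [x Ux ->]; apply: UZ.
have inv (r : R) : ~ (forall x, U x -> r *: x = 0) ->
    exists c, forall x, U x -> c *: (r *: x) = x.
  move=> nr; have [//|rU] := alt r.
  have rnU n : incl U (img ( *:%R (r ^+ n)) U).
    elim: n => [|n IHn] x Ux; first by exists x; rewrite ?scale1r.
    have [y /IHn[z Uz ->] ->] := rU x Ux.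
    by exists z; rewrite // scalerA exprS.
  (* The ideals of powers of [r] stabilize, so r^n = c r^(n+1); this inverts [r] on [U], where every
     element has the form r^n y. *)
  have [||n nP] := artinian_dcc_regular (I := fun n => line (r ^+ n : R^o)).
  - by move=> n; apply: submod_line.
  - by move=> n _ [a ->]; exists (a * r); rewrite exprS scalerA.
  have [c cE] := nP n.+1 (leqnSn n) _ (line_id _).
  exists c => x Ux; have [y Uy ->] := rnU n x Ux.
  rewrite !scalerA -mulrA -exprS; congr (_ *: _); exact: esym cE.
have [N [v [sN aN NU nv vN]]] := dcc_acc_on_nat sU naU.
(* [T n] is the span of v 1, ..., v n; leaving out [v 0] keeps the union of the [T n] proper in
   [U]. *)
pose T n (x : V) := forall M, submod M -> (forall i, (i < n)%N -> M (v i.+1)) -> M x.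
have sT n : submod (T n).
  split=> [|x y Tx Ty|a x Tx] M sM vM; case: (sM) => M0 MD MZ //.
    by apply: MD; [exact: Tx | exact: Ty].
  by apply: MZ; exact: Tx.
have aT : ascending T by move=> n x Tx M sM vM; apply: Tx => // i ?; apply/vM/ltnW.
have TN n : incl (T n) (N n.+1).
  by move=> x; apply=> // i lin; apply: (ascending_le aN _ (vN _)).
have nT n : ~ T n (v 0%N).
  elim: n => [|n IHn] Tv.
    by apply: (nv 0%N); apply: (Tv (N 0%N)).
  have [||_ [x [[a ->] Tx vE]]] := Tv (addsm (line (v n.+1)) (T n)).
  - by apply: submod_add => //; apply: submod_line.
  - move=> i; rewrite ltnS leq_eqVlt => /predU1P[->|lin].
      by apply: incl_addl => //; apply: line_id.
    by apply: incl_addr; [apply: submod_line | move=> M sM; apply].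
  have Uv : U (v n.+1) := NU _ _ (vN _).
  have [aU|/inv[c cP]] := pselect (forall x, U x -> a *: x = 0).
    by apply: IHn; rewrite vE aU // add0r.
  (* Here [a] acts invertibly, so [vE] can be solved for [v n.+1], which then lies in [N n.+1]. *)
  apply: (nv n.+1); rewrite -(cP _ Uv) -[_ *: v n.+1](addrK x) -vE.
  case: (sN n.+1) => _ _ NZ; apply: NZ; apply: submodB => //; last exact: TN.
  exact: (ascending_le aN _ (vN 0%N)).
pose TT x := exists n, T n x.
have sTT : submod TT.
  split=> [|x y [m Tx] [n Ty]|a x [n Tx]].
  - by exists 0%N; case: (sT 0%N).
  - exists (maxn m n); case: (sT (maxn m n)) => _ TD _; apply: TD.
      exact: (ascending_le aT (leq_maxl _ _)).
    exact: (ascending_le aT (leq_maxr _ _)).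
  - by exists n; case: (sT n) => _ _; apply.
(* The union misses [v 0], so by minimality of [U] it satisfies ACC, although the [T n] increase
   strictly. *)
have [|||||n nP] := small TT sTT _ _ T.
- by move=> x [n /TN /NU].
- by move=> UTT; have [|n /nT] := UTT (v 0%N); first exact: NU (vN _).
- exact: sT.
- by move=> n x; exists n.
- exact: aT.
apply: (nv n.+1); apply: TN; apply: (nP n.+1) => //.
by move=> M _; apply.
Qed.

Lemma acc_fg (V : lmodType R) : finitely_generated V -> acc V.
Proof. by move=> /dcc_fgen/dcc_acc. Qed.

End ArtinianRings.

(** * Injective cogenerator *)

Section FinitelyGenerated.
Variable A : pzRingType.

Lemma finitely_generated_img (V Q : lmodType A) (p : {linear V -> Q}) :
  (forall q, exists x, q = p x) -> finitely_generated V -> finitely_generated Q.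
Proof.
move=> sp [n [e eV]]; exists n, (p \o e) => q.
have [x ->] := sp q; have [c ->] := eV x; exists c.
by rewrite linear_sum; apply: eq_bigr => i _; rewrite linearZ.
Qed.

Lemma finitely_generated_finType (V : lmodType A) (I : finType) (e : I -> V) :
  (forall x, exists c : I -> A, x = \sum_i c i *: e i) -> finitely_generated V.
Proof.
move=> eV; exists #|I|, (e \o enum_val) => x; have [c ->] := eV x.
exists (c \o enum_val); rewrite (reindex (@enum_val I xpredT)) //.
exact/onW_bij/enum_val_bij.
Qed.

Lemma finitely_generated_prod (V W : lmodType A) :
  finitely_generated V -> finitely_generated W ->
  finitely_generated (V * W)%type.
Proof.
move=> [n [e eV]] [m [d dW]].
apply: (@finitely_generated_finType _ ('I_n + 'I_m)%type
  (fun u => match u with inl i => (e i, 0) | inr j => (0, d j) end)).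
move=> [x y]; have [a xE] := eV x; have [b yE] := dW y.
exists (fun u => match u with inl i => a i | inr j => b j end).
rewrite big_sumType /=.
have <- : (x, 0) = \sum_i a i *: (e i, 0 : W).
  rewrite xE; apply: (big_ind2 (fun u p => (u, 0) = p)) => //.
    by move=> u _ v _ <- <-; rewrite -[RHS]/(u + v, 0 + 0) addr0.
  by move=> i _; rewrite -[RHS]/(a i *: e i, a i *: 0) scaler0.
have <- : (0, y) = \sum_i b i *: (0 : V, d i).
  rewrite yE; apply: (big_ind2 (fun u p => (0, u) = p)) => //.
    by move=> u _ v _ <- <-; rewrite -[RHS]/(0 + 0, u + v) addr0.
  by move=> i _; rewrite -[RHS]/(b i *: 0, b i *: d i) scaler0.
by rewrite -[RHS]/(x + 0, 0 + y) addr0 add0r.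
Qed.

Definition fdelta (V : lmodType A) n (i : 'I_n) (v : V) : {ffun 'I_n -> V} :=
  [ffun j => if j == i then v else 0].

Lemma fdelta_is_linear (V : lmodType A) n (i : 'I_n) : linear (@fdelta V n i).
Proof.
by move=> a x y; apply/ffunP => j; rewrite !ffunE; case: eqP; rewrite ?scaler0 ?addr0.
Qed.

Lemma ffun_sum_fdelta (V : lmodType A) n (f : {ffun 'I_n -> V}) :
  f = \sum_i fdelta i (f i).
Proof.
apply/ffunP => j; rewrite sum_ffunE (bigD1 j) //= ffunE eqxx big1 ?addr0 // => i ij.
by rewrite ffunE eq_sym (negPf ij).
Qed.

Lemma finitely_generated_ffun (V : lmodType A) n :
  finitely_generated V -> finitely_generated {ffun 'I_n -> V}.
Proof.
move=> [m [e eV]].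
apply: (@finitely_generated_finType _ ('I_n * 'I_m)%type (fun u => fdelta u.1 (e u.2))).
move=> f; have /choice[c cE] i := eV (f i).
exists (fun u => c u.1 u.2); rewrite [LHS]ffun_sum_fdelta.
rewrite -(pair_big xpredT xpredT (fun i j => c i j *: fdelta i (e j))) /=.
apply: eq_bigr => i _; rewrite cE -[fdelta i]/(mklin (@fdelta_is_linear V n i) : _ -> _).
by rewrite linear_sum; apply: eq_bigr => j _; rewrite linearZ.
Qed.

Lemma finitely_generated_regular : finitely_generated A^o.
Proof.
by exists 1%N, (fun=> 1) => x; exists (fun=> x); rewrite big_ord1; exact: esym (mulr1 x).
Qed.

(** A map on a submodule is encoded as a total function with arbitrary values outside [U], which
    avoids submodule types. *)
Definition lin_on (V W : lmodType A) (U : V -> Prop) (f : V -> W) : Prop :=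
  forall a x y, U x -> U y -> f (a *: x + y) = a *: f x + f y.

Lemma lin_on0 (V W : lmodType A) (U : V -> Prop) (f : V -> W) :
  submod U -> lin_on U f -> f 0 = 0.
Proof.
case=> U0 _ _ lf; have := lf 1 0 0 U0 U0.
by rewrite !scale1r addr0 => /eqP; rewrite addrC -subr_eq subrr => /eqP.
Qed.

Lemma lin_onZ (V W : lmodType A) (U : V -> Prop) (f : V -> W) a x :
  submod U -> lin_on U f -> U x -> f (a *: x) = a *: f x.
Proof.
move=> sU lf Ux; have U0 : U 0 by case: sU.
by rewrite -[a *: x]addr0 lf // (lin_on0 sU lf) addr0.
Qed.

Lemma lin_onB (V W : lmodType A) (U : V -> Prop) (f : V -> W) x y :
  lin_on U f -> U x -> U y -> f (x - y) = f x - f y.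
Proof. by move=> lf Ux Uy; rewrite addrC -scaleN1r lf // scaleN1r addrC. Qed.

Lemma lin_onW (V W : lmodType A) (U U' : V -> Prop) (f : V -> W) :
  incl U' U -> lin_on U f -> lin_on U' f.
Proof. by move=> sUU' lf a x y /sUU' Ux /sUU' Uy; exact: lf. Qed.

End FinitelyGenerated.

(** * Faithful socle distinct modules are injective cogenerators *)

Section InjectiveCogenerator.
Variable R : comPzRingType.
Hypothesis artR : artinian R.

Let dccR : dcc R^o := artinian_dcc_regular artR.
Let accR : acc R^o := dcc_acc artR dccR.

Lemma scaler_swap (V : lmodType R) (a b : R) (v : V) : a *: (b *: v) = b *: (a *: v).
Proof. by rewrite !scalerA mulrC. Qed.

Definition simple_elt (V : lmodType R) (s : V) : Prop :=
  s <> 0 /\ forall r : R, r *: s = 0 \/ exists c, c *: (r *: s) = s.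

(** The annihilator of a simple [s] is a maximal ideal, so an [s'] killed by it is 0 or spans an
    isomorphic simple module, which has to be the same submodule. *)
Definition socle_distinct (V : lmodType R) : Prop := forall s s' : V,
  simple_elt s -> (forall r : R, r *: s = 0 -> r *: s' = 0) -> line s s'.

Definition faithful (V : lmodType R) : Prop :=
  forall r : R, (forall x : V, r *: x = 0) -> r = 0.

Section Given.
Variable J : lmodType R.
Hypothesis sdJ : socle_distinct J.

(* Noetherian induction on the ideal I: f is a multiple of w on the elements x
   with I w(x) = 0. *)
Lemma scalar_multiple (V : lmodType R) (U : V -> Prop) (w f : V -> J) :
  submod U -> lin_on U w -> lin_on U f ->
  (forall x, U x -> w x = 0 -> f x = 0) ->
  exists r, forall x, U x -> f x = r *: w x.
Proof.
move=> sU lw lf kwf; apply: contrapT => nmul.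
pose kills (I : R^o -> Prop) x := U x /\ forall b, I b -> b *: w x = 0.
pose bad (I : R^o -> Prop) := ~ exists r, forall x, kills I x -> f x = r *: w x.
have [|I [sI badI Imax]] := @acc_max _ R^o bad accR.
  exists (fun x => x = 0); first exact: submod_zero.
  move=> [r rE]; apply: nmul; exists r => x Ux; apply: rE; split=> // b ->.
  exact: scale0r.
have nI1 : ~ I 1.
  move=> I1; apply: badI; exists 0 => x [Ux Ix]; rewrite scale0r.
  by apply: kwf => //; rewrite -[w x]scale1r; apply: Ix.
(* [I'] is minimal above [I], so I'/I is simple and generated by any element of [I'] outside [I]. *)
have [|I' [sI' [II' nI'I] I'min]] :=
    @dcc_min _ R^o (fun I' => incl I I' /\ ~ incl I' I) dccR.
  by exists (fun=> True); [exact: submod_true | split=> // /(_ 1)-/(_ Logic.I)].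
have [a [I'a nIa]] : exists a, I' a /\ ~ I a.
  apply: contrapT => na; apply: nI'I => a I'a; apply: contrapT => nIa.
  by apply: na; exists a.
have gen b : I' b -> ~ I b -> incl I' (addsm I (line (b : R^o))).
  move=> I'b nIb; apply: I'min; first by apply: submod_add => //; apply: submod_line.
    split; first by apply: incl_addl; apply: submod_line.
    by move/(_ b (incl_addr sI (line_id _)))/nIb.
  by move=> _ [x [_ [/II' I'x [c ->] ->]]]; case: sI' => _ ID IZ; apply: ID; auto.
have Ira (r : R) : I (r * a) \/ exists c, I (a - c * (r * a)).
  have [|nIra] := pselect (I (r * a)); first by left.
  have [|i [_ [Ii [c ->] aE]]] := gen (r * a) _ nIra _ I'a.
    by case: sI' => _ _ IZ; exact: (IZ r).
  by right; exists c; rewrite {1}aE addrK.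
have [r0 r0E] : exists r, forall x, kills I' x -> f x = r *: w x.
  by apply: contrapT => badI'; apply: nI'I; apply: Imax.
(* The remainder [g] vanishes on [kills I'], while [badI] makes it nonzero at some [x0] in
   [kills I]. *)
pose g x := f x - r0 *: w x.
have lg : lin_on U g.
  move=> c x y Ux Uy; rewrite /g lf // lw // !scalerDr !scalerA.
  by rewrite opprD addrACA scalerN scalerA (mulrC r0).
have g0 x : U x -> (forall b, I b -> b *: w x = 0) -> a *: w x = 0 -> g x = 0.
  move=> Ux kx ax; rewrite /g r0E ?subrr //; split=> // b I'b.
  have [i [_ [Ii [c ->] ->]]] := gen a I'a nIa b I'b.
  by rewrite scalerDl kx // add0r -scalerA ax scaler0.
have [x0 [[Ux0 kx0] gx0]] : exists x, kills I x /\ g x <> 0.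
  apply: contrapT => ng; apply: badI; exists r0 => x kx; apply/eqP.
  by rewrite -subr_eq0; apply/eqP; apply: contrapT => gx; apply: ng; exists x.
(* An [r] kills [s0] exactly when [r * a] is in [I], so [s0] spans a copy of I'/I and is simple. *)
pose s0 := a *: w x0.
have sa0 (r : R) : r *: s0 = 0 -> I (r * a).
  have [//|[c Ic]] := Ira r => rs0; case: gx0; apply: g0 => //.
  move/kx0: Ic; rewrite scalerBl -scalerA -scalerA -/s0 rs0 scaler0 subr0.
  by [].
have sim : simple_elt s0.
  split=> [s00|r]; first by apply/gx0/g0.
  have [Ira'|[c Ic]] := Ira r; first by left; rewrite scalerA kx0.
  right; exists c; move/kx0: Ic; rewrite scalerBl -!scalerA -/s0.
  by move/eqP; rewrite subr_eq0 => /eqP.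
have [c cE] : line s0 (g x0).
  apply: sdJ sim _ => r /sa0 Ira'; rewrite -(lin_onZ _ sU lg) //.
  have Urx : U (r *: x0) by case: sU => _ _; apply.
  apply: g0 => [//|b Ib|]; rewrite (lin_onZ _ sU lw) // scalerA mulrC ?kx0 //.
  by case: sI => _ _ IZ; exact: (IZ r b).
(* Each [a *: w x] is some [d *: s0]; then g(x - d x0) = 0, so g(x) = d g(x0) = c a w(x). *)
apply: badI; exists (r0 + c * a) => x [Ux kx].
have [d dE] : line s0 (a *: w x).
  by apply: sdJ sim _ => r /sa0 Ira'; rewrite scalerA kx.
have Udx : U (d *: x0) by case: sU => _ _; apply.
have gy : g (x - d *: x0) = 0.
  have wy : w (x - d *: x0) = w x - d *: w x0.
    by rewrite (lin_onB lw) // (lin_onZ _ sU lw).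
  apply: g0 => [|b Ib|]; first exact: submodB.
    by rewrite wy scalerBr kx // scalerA mulrC -scalerA kx0 // scaler0 subr0.
  by rewrite wy scalerBr dE scalerA (mulrC a) -scalerA subrr.
have gE : g x = (c * a) *: w x.
  move: gy; rewrite (lin_onB lg) // (lin_onZ _ sU lg) // cE => /eqP.
  by rewrite subr_eq0 => /eqP ->; rewrite -scalerA dE; exact: scaler_swap.
by rewrite scalerDl -gE /g addrC subrK.
Qed.

Definition fun_space (V : lmodType R) (U : V -> Prop) (W : (V -> J) -> Prop) : Prop :=
  [/\ forall w, W w -> lin_on U w, W (fun=> 0) &
      forall w w' a, W w -> W w' -> W (fun x => w x + a *: w' x)].

(** Call [K] sufficient if a map agreeing with some member of [W] on [K] agrees with some member on
    all of [U]. By [scalar_multiple], a sufficient [K] may be cut by the kernel of any [w] in [W];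
    so [W] vanishes on a minimal one, where [f] then agrees with 0. *)
Lemma double_annihilator (V : lmodType R) (U : V -> Prop) (W : (V -> J) -> Prop)
    (f : V -> J) :
  dcc V -> submod U -> fun_space U W -> lin_on U f ->
  (forall x, U x -> (forall w, W w -> w x = 0) -> f x = 0) ->
  exists2 w, W w & forall x, U x -> f x = w x.
Proof.
move=> dV sU [lW W0 WD] lf kf.
pose P (K : V -> Prop) := incl K U /\ forall f, lin_on U f ->
  (exists2 w, W w & forall x, K x -> f x = w x) ->
  exists2 w, W w & forall x, U x -> f x = w x.
have [|K [sK [KU PK] Kmin]] := @dcc_min _ V P dV; first by exists U => //; split=> // x.
apply: (PK) => //; exists (fun=> 0) => // x Kx; apply: kf; first exact: KU.
move=> w Ww; have lw : lin_on K w := lin_onW KU (lW _ Ww).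
pose K' x := K x /\ w x = 0.
have sK' : submod K'.
  case: (sK) => K0 KD KZ; split=> [|y z [Ky wy] [Kz wz]|a y [Ky wy]].
  - by split=> //; apply: lin_on0 lw.
  - by split; [exact: KD | rewrite -[y]scale1r lw // wy wz scaler0 addr0].
  - by split; [exact: KZ | rewrite (lin_onZ _ sK lw) // wy scaler0].
suff : incl K K' by case/(_ x Kx).
apply: Kmin => // [|y []//]; split=> [y [/KU]//|f' lf' [w' Ww' f'E]].
have [||r rE] := @scalar_multiple V K w (fun x => f' x - w' x) sK lw.
- move=> a y z /KU Uy /KU Uz; rewrite lf' // (lW _ Ww') //.
  by rewrite opprD addrACA scalerBr.
- by move=> y Ky wy; rewrite f'E ?subrr.
apply: PK => //; exists (fun x => w' x + r *: w x); first exact: WD.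
by move=> y Ky; rewrite -rE // addrC subrK.
Qed.

Hypothesis fgJ : finitely_generated J.
Hypothesis faithJ : faithful J.

(** Otherwise the multiplications by elements of [I] have no common zero but 0, so the identity of
    [J] is one of them and faithfulness puts 1 in [I]. *)
Lemma annihilated_elt (I : R^o -> Prop) : submod I -> ~ I 1 ->
  exists2 s : J, s <> 0 & forall a, I a -> a *: s = 0.
Proof.
move=> sI nI1; apply: contrapT => ns; apply: nI1; case: (sI) => I0 ID IZ.
pose W (w : J -> J) := exists2 a, I a & forall x, w x = a *: x.
have [||//||w [a Ia wE] aE] := @double_annihilator J (fun=> True) W id (dcc_fgen artR fgJ).
- exact: submod_true.
- split=> [w [a _ wE] b x y _ _||w w' b [a Ia wE] [a' Ia' w'E]].
  + by rewrite !wE scalerDr !scalerA mulrC.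
  + by exists 0 => // x; rewrite scale0r.
  + exists (a + b * a'); first by apply: ID => //; apply: (IZ b).
    by move=> x; rewrite wE w'E scalerDl scalerA.
- move=> s _ ks; apply: contrapT => s0; apply: ns; exists s => // a Ia.
  by apply: (ks ( *:%R a)); exists a.
suff /eqP : 1 - a = 0 by rewrite subr_eq0 => /eqP ->.
by apply: faithJ => x; rewrite scalerBl scale1r -wE -aE ?subrr.
Qed.

(** Baer's criterion: by faithfulness the maps a |-> a j have only 0 as common zero, so
    [double_annihilator] finds [f] among them. *)
Lemma baer (I : R^o -> Prop) (f : R^o -> J) : submod I -> lin_on I f ->
  exists j, forall a, I a -> f a = a *: j.
Proof.
move=> sI lf.
have [|||w [j wE] fE] := @double_annihilator R^o I
  (fun w => exists j, forall a : R, w a = a *: j) f dccR sI.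
- split=> [w [j wE] b x y _ _||w w' b [j wE] [j' w'E]].
  + by rewrite !wE scalerDl scalerA.
  + by exists 0 => x; rewrite scaler0.
  + by exists (j + b *: j') => x; rewrite wE w'E scalerDr !scalerA mulrC.
- exact: lf.
- move=> a _ ka; suff -> : a = 0 by apply: lin_on0 lf.
  by apply: faithJ => j; apply: (ka (fun b => b *: j)); exists j.
by exists j => a Ia; rewrite fE.
Qed.

Lemma extend_line (V : lmodType R) (U : V -> Prop) (f : V -> J) (x : V) (j : J) :
  submod U -> lin_on U f -> (forall a, U (a *: x) -> f (a *: x) = a *: j) ->
  exists f', [/\ lin_on (addsm U (line x)) f', forall y, U y -> f' y = f y & f' x = j].
Proof.
move=> sU lf fj; case: (sU) => U0 UD UZ.
have /choice[p pE] (y : V) : exists p : V * R, addsm U (line x) y ->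
    U p.1 /\ y = p.1 + p.2 *: x.
  have [[u [_ [Uu [c ->] ->]]]|n] := pselect (addsm U (line x) y).
    by exists (u, c).
  by exists (0, 0).
pose f' y := f (p y).1 + (p y).2 *: j.
have f'E u c : U u -> f' (u + c *: x) = f u + c *: j.
  move=> Uu; have [|Up E] := pE (u + c *: x); first by exists u, (c *: x); split=> //; exists c.
  rewrite /f'; move: (p _) Up E => [v d] /= Uv E.
  have dE : (c - d) *: x = v - u.
    by rewrite scalerBl; apply/eqP; rewrite subr_eq addrAC -E addrC addKr.
  have /fj : U ((c - d) *: x) by rewrite dE; apply: submodB.
  rewrite dE (lin_onB lf) // scalerBl => /eqP; rewrite subr_eq => /eqP ->.
  by rewrite addrAC subrK addrC.
exists f'; split=> [a _ _ [u [_ [Uu [c ->] ->]]] [v [_ [Uv [d ->] ->]]]|y Uy|].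
- rewrite scalerDr addrACA scalerA -scalerDl !f'E; auto.
  by rewrite lf // scalerDl scalerDr scalerA addrACA.
- by rewrite -[y in LHS]addr0 -(scale0r x) f'E // scale0r addr0.
- by rewrite -[x in LHS]add0r -[x in LHS]scale1r f'E // (lin_on0 sU lf) add0r scale1r.
Qed.

(** An [s] killed by the annihilator of [v] modulo [N] defines a map on [N] plus the line of [v]. A
    maximal extension is defined everywhere, since [baer] supplies a value at any further [x]. *)
Lemma cogenerator (V : lmodType R) (N : V -> Prop) (v : V) :
  finitely_generated V -> submod N -> ~ N v ->
  exists2 f : {linear V -> J}, forall x, N x -> f x = 0 & f v <> 0.
Proof.
move=> fgV sN nNv; have aV := acc_fg artR fgV.
have sv : submod (fun a : R^o => N (a *: v)).
  case: (sN) => N0 ND NZ; split=> [|a b|a b]; first by rewrite scale0r.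
    by rewrite scalerDl; apply: ND.
  by move/(NZ a); rewrite scalerA.
have [|s s0 sP] := annihilated_elt sv; first by rewrite scale1r.
pose P (U : V -> Prop) := incl (addsm N (line v)) U /\
  exists f : V -> J, [/\ lin_on U f, forall x, N x -> f x = 0 & f v = s].
have [|U [sU [NU [f [lf fN fv]]] Umax]] := @acc_max _ V P aV.
  exists (addsm N (line v)); first by apply: submod_add => //; apply: submod_line.
  split; first exact: incl_refl.
  have [|a /sP ->//|f [lf fN fv]] := @extend_line V N (fun=> 0) v s sN.
    by move=> a x y _ _; rewrite scaler0 addr0.
  by exists f.
have UT x : U x.
  have sI : submod (fun a : R^o => U (a *: x)).
    case: (sU) => U0 UD UZ; split=> [|a b|a b]; first by rewrite scale0r.
      by rewrite scalerDl; apply: UD.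
    by move/(UZ a); rewrite scalerA.
  have [|j jP] := @baer _ (fun a : R^o => f (a *: x)) sI.
    by move=> a b c Ub Uc; rewrite scalerDl -scalerA lf.
  have [f' [lf' f'f _]] := extend_line sU lf jP.
  apply: (Umax (addsm U (line x))).
  - by apply: submod_add => //; apply: submod_line.
  - split; first by apply: incl_trans NU _; apply: incl_addl; apply: submod_line.
    exists f'; split=> // [y Ny|].
      by rewrite f'f ?fN //; apply: NU; apply: incl_addl Ny; apply: submod_line.
    by rewrite f'f //; apply: NU; apply: incl_addr (line_id _).
  - by apply: incl_addl; apply: submod_line.
  - exact: incl_addr (line_id _).
have lf' : linear f by move=> a x y; apply: lf.
by exists (mklin lf') => [x /fN|]; rewrite mklinE // fv.
Qed.

End Given.

End InjectiveCogenerator.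

(** * Construction of a faithful socle distinct module *)

Section CogeneratorExists.
Variable R : comPzRingType.
Hypothesis artR : artinian R.

Lemma simple_elt_unscale (V : lmodType R) (s : V) (r : R) :
  simple_elt s -> r *: s <> 0 -> line (r *: s) s.
Proof. by case=> _ /(_ r)[|[c cE]] // _; exists c. Qed.

Lemma simple_elt_ann (V W : lmodType R) (s : V) (t : W) : simple_elt s -> t <> 0 ->
  (forall r : R, r *: s = 0 -> r *: t = 0) -> simple_elt t.
Proof.
move=> [s0 sP] t0 st; split=> // r; have [/st|[c cE]] := sP r; first by left.
right; exists c; have : (1 - c * r) *: t = 0.
  by apply: st; rewrite scalerBl scale1r -scalerA cE subrr.
by rewrite scalerBl scale1r -scalerA => /eqP; rewrite subr_eq0 => /eqP.
Qed.

(* In a quotient Q of J x R that is essential over the image of J and over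
   the image r0 of r, every simple element lies in one of the two; two simple
   elements with the same annihilator, one in each, are compared through
   their sum. *)
Lemma socle_distinct_amalgam (J Q : lmodType R) (i : {linear J -> Q}) (r0 : Q) :
  injective i -> socle_distinct J ->
  (forall w, simple_elt w -> (exists j, w = i j) \/ (line w r0 /\ line r0 w)) ->
  socle_distinct Q.
Proof.
move=> iI sdJ ess w w' sw ww'.
have i0 j : i j = 0 -> j = 0 by rewrite -(linear0 i) => /iI.
have both j j' : w = i j -> w' = i j' -> line w w'.
  move=> wE w'E; have sj : simple_elt j.
    apply: (simple_elt_ann sw) => [j0|r]; first by case: sw => + _; rewrite wE j0 linear0.
    by rewrite wE -linearZ => /i0.
  have [r|c cE] := sdJ j j' sj; last by exists c; rewrite wE w'E cE linearZ.
  move=> rj; apply: i0; rewrite linearZ /= -w'E; apply: ww'.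
  by rewrite wE -linearZ /= rj linear0.
have [->|w'0] := pselect (w' = 0); first by exists 0; rewrite scale0r.
have [/eqP|ww'0] := pselect (w + w' = 0).
  by rewrite addr_eq0 => /eqP ->; exists (-1); rewrite scaleN1r opprK.
have sw' := simple_elt_ann sw w'0 ww'.
have sww' : simple_elt (w + w').
  by apply: (simple_elt_ann sw) => // r rw; rewrite scalerDr rw ww' // addr0.
have [[j wE]|[[c wr] [d rw]]] := ess _ sw; have [[j' w'E]|[[c' wr'] [d' rw']]] := ess _ sw'.
- exact: both wE w'E.
- have [[k kE]|[_ [e eE]]] := ess _ sww'.
    by apply: (both j (k - j)) => //; rewrite linearB /= -kE -wE addrC addKr.
  have wE' : w = ((e - d') * c') *: w'.
    by rewrite -scalerA -wr' scalerBl -eE -rw' addrK.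
  rewrite wE'; apply: simple_elt_unscale => //; rewrite -wE'.
  by case: sw.
- have [[k kE]|[_ [e eE]]] := ess _ sww'.
    by apply: (both (k - j') j') => //; rewrite linearB /= -kE -w'E addrK.
  by exists (e * c - 1); rewrite scalerBl -scalerA -wr -eE scale1r addrC addKr.
- by exists (d' * c); rewrite -scalerA -wr.
Qed.

Lemma injective_cogenerator_exists : exists J : lmodType R,
  [/\ finitely_generated J, socle_distinct J & faithful J].
Proof.
have dccR := artinian_dcc_regular artR.
pose P (I : R^o -> Prop) := exists J : lmodType R, [/\ finitely_generated J,
  socle_distinct J & forall r : R, I r <-> forall x : J, r *: x = 0].
have [|I [sI [J [fgJ sdJ JI]] Imin]] := @dcc_min _ R^o P dccR.
  pose Z : lmodType R := {ffun 'I_0 -> R^o}.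
  have Z0 (x y : Z) : x = y by apply/ffunP; case.
  exists (fun=> True); first exact: submod_true.
  exists Z; split=> [|s s' [/(_ (Z0 _ _))] //|r]; last by split.
  by exists 0%N, (fun=> 0) => x; exists (fun=> 0).
exists J; split=> // r rJ; apply: contrapT => r0.
pose V : lmodType R := (J * R^o)%type.
have fgV : finitely_generated V.
  by apply: finitely_generated_prod => //; apply: finitely_generated_regular.
(* Modulo such an [N], [J] stays embedded and [r] does not kill the image of (0, 1). *)
pose ok (N : V -> Prop) := (forall j, N (j, 0) -> j = 0) /\ ~ N (0, r : R^o).
have [|N [sN [NJ Nr] Nmax]] := @acc_max _ V ok (acc_fg artR fgV).
  by exists (fun v => v = 0); [exact: submod_zero | split=> [j []|[]]].
have [Q [p [pS pK]]] := quotient_exists sN.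
have lin1 : linear (fun j : J => p (j, 0)).
  move=> a x y; rewrite -linearP; congr (p _).
  by rewrite -[RHS]/(a *: x + y, a *: 0 + 0) scaler0 addr0.
pose i := mklin lin1.
have iE j : i j = p (j, 0) by [].
have iI : injective i.
  move=> x y xy; apply/eqP; rewrite -subr_eq0; apply/eqP/NJ/pK.
  by rewrite -iE linearB xy subrr.
have r0E : r *: p (0, 1 : R^o) = p (0, r : R^o).
  rewrite -linearZ; congr (p _).
  by rewrite -[LHS]/(r *: 0, r * 1) scaler0 mulr1.
have sdQ : socle_distinct Q.
  apply: (@socle_distinct_amalgam J Q i (p (0, r : R^o))) => // w sw.
  have [v wE] := pS w.
  (* By maximality of [N], the line of [w] meets the image of [J] nontrivially or contains that of
     [r]; simplicity of [w] turns this into the two alternatives. *)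
  have nok : ~ ok (addsm (line v) N).
    move=> okN; have sline := submod_line v.
    have := Nmax _ (submod_add sline sN) okN (incl_addr sline) v.
    move=> /(_ (incl_addl sN (line_id v)))/pK; rewrite -wE.
    by case: sw.
  have meet x c n : x = c *: v + n -> N n -> p x = c *: w.
    by move=> -> /pK n0; rewrite linearD n0 addr0 linearZ wE.
  apply: contrapT => /not_orP[nJ nr]; apply: nok; split=> [j|] [_ [n [[c ->] Nn xE]]].
    apply: contrapT => j0; apply: nJ; have E := meet _ _ _ xE Nn.
    have [|d dE] := simple_elt_unscale (r := c) sw.
      by rewrite -E -iE -(linear0 i) => /iI.
    by exists (d *: j); rewrite linearZ iE /= E.
  have E := meet _ _ _ xE Nn; apply: nr; split; first by exists c.
  by rewrite E; apply: simple_elt_unscale => //; rewrite -E => /pK.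
have fgQ : finitely_generated Q by apply: finitely_generated_img fgV.
pose I' (a : R^o) := forall x : Q, (a : R) *: x = 0.
have I'I : incl I' I.
  by move=> a aQ; apply/JI => j; apply: iI; rewrite linear0 linearZ; exact: aQ.
have sI' : submod I'.
  split=> [x|a b Ia Ib x|c a Ia x]; first by rewrite scale0r.
    by rewrite scalerDl Ia Ib addr0.
  by rewrite -scalerA Ia scaler0.
have II' : incl I I' by apply: Imin => //; exists Q; split.
by apply/Nr/pK; rewrite -r0E; apply: (II' r); apply/JI.
Qed.
End CogeneratorExists.

(** * Restriction of scalars and local endomorphism rings *)

Section RestrictScalars.
Variables (R : comPzRingType) (L : pzRingType) (phi : {rmorphism R -> L}).

(** The alias records [phi], so that the R-module structure can be attached to it as an instance. *)
Definition res_sort of {rmorphism R -> L} : lmodType L -> Type := fun M => M.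
Local Notation res := (res_sort phi).

HB.instance Definition _ (M : lmodType L) := GRing.Zmodule.on (res M).

Definition res_scale (M : lmodType L) (r : R) (x : res M) : res M := phi r *: (x : M).

Lemma res_scaleA (M : lmodType L) a b (x : res M) :
  res_scale a (res_scale b x) = res_scale (a * b) x.
Proof. by rewrite /res_scale scalerA rmorphM. Qed.

Lemma res_scale1 (M : lmodType L) : left_id 1 (@res_scale M).
Proof. by move=> x; rewrite /res_scale rmorph1 scale1r. Qed.

Lemma res_scaleDr (M : lmodType L) : right_distributive (@res_scale M) +%R.
Proof. by move=> a x y; exact: scalerDr. Qed.

Lemma res_scaleDl (M : lmodType L) (x : res M) : {morph (@res_scale M)^~ x : a b / a + b}.
Proof. by move=> a b; rewrite /res_scale rmorphD scalerDl. Qed.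

HB.instance Definition _ (M : lmodType L) := GRing.Zmodule_isLmodule.Build R (res M)
  (@res_scaleA M) (@res_scale1 M) (@res_scaleDr M) (@res_scaleDl M).

Lemma res_scaleE (M : lmodType L) (r : R) (x : M) : r *: (x : res M) = phi r *: x :> M.
Proof. by []. Qed.

Lemma submod_res (M : lmodType L) (N : M -> Prop) : submod N -> submod (N : res M -> Prop).
Proof. by case=> N0 ND NZ; split=> // r x; apply: (NZ (phi r)). Qed.

Hypothesis artL : artin_algebra phi.

Lemma finitely_generated_res (M : lmodType L) :
  finitely_generated M -> finitely_generated (res M).
Proof.
case: artL => _ central [n [l lL]] [m [e eM]].
apply: (@finitely_generated_finType R (res M) ('I_m * 'I_n)%type
  (fun u => (l u.2 *: e u.1 : res M))) => x.
have [c ->] := eM x; have /choice[d dE] i := lL (c i).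
exists (fun u => d u.1 u.2).
rewrite -(pair_big xpredT xpredT (fun i j => d i j *: (l j *: e i : res M))) /=.
apply: eq_bigr => i _; rewrite {1}dE scaler_suml.
by apply: eq_bigr => j _; rewrite [RHS]res_scaleE scalerA.
Qed.

Lemma artin_dcc (M : lmodType L) : finitely_generated M -> dcc M.
Proof.
move=> /finitely_generated_res/dcc_fgen dM I sI; case: artL => artR _ _.
exact: (dM artR I (fun n => submod_res (sI n))).
Qed.

Lemma artin_acc (M : lmodType L) : finitely_generated M -> acc M.
Proof.
move=> /finitely_generated_res/acc_fg aM I sI; case: artL => artR _ _.
exact: (aM artR I (fun n => submod_res (sI n))).
Qed.

End RestrictScalars.

(** * Fitting's lemma and its consequences *)

Section Indecomposables.
Variable L : pzRingType.

Lemma is_iso_bij (M N : lmodType L) (f : {linear M -> N}) :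
  is_iso f <-> injective f /\ forall y, exists x, y = f x.
Proof.
split=> [[g [fg gf]]|[fI /choice[g gP]]].
  by split=> [|y]; [exact: can_inj fg | exists (g y); rewrite gf].
have gf x : g (f x) = x by apply: fI; rewrite -gP.
have lg : linear g by move=> a x y; apply: fI; rewrite -gP linearP -!gP.
by exists (mklin lg); split=> // y; rewrite mklinE -gP.
Qed.

Lemma linear_inj0 (M N : lmodType L) (f : {linear M -> N}) :
  (forall x, f x = 0 -> x = 0) -> injective f.
Proof.
move=> f0 x y fxy; apply/eqP; rewrite -subr_eq0; apply/eqP/f0.
by rewrite linearB /= fxy subrr.
Qed.

(* X is isomorphic to X/M x X/N, which avoids building submodule types. *)
Lemma indecomposable_complement (X : lmodType L) (M N : X -> Prop) :
  indecomposable X -> submod M -> submod N ->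
  (forall x, M x -> N x -> x = 0) -> (forall x, addsm M N x) ->
  (forall x, M x) \/ (forall x, N x).
Proof.
move=> [_ indX] sM sN MN0 MNT.
have [P [p [pS pK]]] := quotient_exists sM.
have [Q [q [qS qK]]] := quotient_exists sN.
have lf : linear (fun x => (p x, q x)) by move=> a x y; rewrite !linearP.
have : isomorphic X (P * Q)%type.
  exists (mklin lf); apply/is_iso_bij; split.
    by apply: linear_inj0 => x [/pK Mx /qK Nx]; apply: MN0.
  move=> [u v]; have [x ->] := pS u; have [y ->] := qS v.
  have [m [n [/pK pm /qK qn xyE]]] := MNT (x - y).
  exists (x - m); rewrite mklinE linearB pm subr0; congr (_, _).
  have -> : x - m = y + n by rewrite -[x](subrK y) xyE -(addrA m) (addrC m) addrK addrC.
  by rewrite linearD qn addr0.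
by case/indX => z; [left=> x; apply/pK | right=> x; apply/qK].
Qed.

Lemma iter_is_linear (X : lmodType L) (f : {linear X -> X}) n : linear (iter n f).
Proof. by move=> a x y; elim: n => //= n ->; rewrite linearP. Qed.

(** For large k, [X] is the direct sum of the kernel and the image of f^k, so one of them is
    everything. *)
Lemma fitting (X : lmodType L) (f : {linear X -> X}) :
  dcc X -> acc X -> indecomposable X ->
  (exists n, forall x, iter n f x = 0) \/ is_iso f.
Proof.
move=> dX aX indX; pose fn n := mklin (iter_is_linear f n).
have [||n nP] := dX (fun n => img (fn n) (fun=> True)).
- by move=> n; apply: submod_img.
- by move=> n _ [x _ ->]; exists (f x); rewrite // !mklinE -iterSr.
have [|||m mP] := aX (fun n x => fn n x = 0).
- by move=> k; apply: submod_ker.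
- by [].
- by move=> k x; rewrite !mklinE /= => ->; rewrite linear0.
(* The successor lets one factor [f] be split off f^k when bijectivity of [f] is read off. *)
pose k := (maxn n m).+1.
have nk : (n <= k)%N by rewrite ltnW // ltnS leq_maxl.
have mk : (m <= k)%N by rewrite ltnW // ltnS leq_maxr.
have imk : incl (img (fn k) (fun=> True)) (img (fn (k + k)) (fun=> True)).
  move=> _ [x _ ->]; apply: (nP (k + k)%N); first exact: leq_trans (leq_addr _ _).
  rewrite /k in nk *; exists (iter (k - n) f x) => //; rewrite !mklinE -iterD.
  by rewrite subnKC.
have kerk x : iter (k + k) f x = 0 -> iter k f x = 0.
  move=> /(mP (k + k)%N (leq_trans mk (leq_addr _ _))) mx.
  by rewrite -(subnK mk) iterD -(mklinE (iter_is_linear f m)) mx; apply: (linear0 (fn _)).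
have K0 x : iter k f x = 0 -> img (fn k) (fun=> True) x -> x = 0.
  move=> kx [y _ xE]; move: kx; rewrite xE !mklinE -iterD; exact: kerk.
have [||kT|iT] := @indecomposable_complement X _ _ indX
    (submod_ker (fn k)) (submod_img (fn k) (submod_true X)).
- exact: K0.
- move=> x; have [|y _ yE] := imk (fn k x); first by exists x.
  exists (x - fn k y), (fn k y); rewrite subrK; split=> //; last by exists y.
  by rewrite linearB yE !mklinE -iterD subrr.
- by left; exists k.
- right; apply/is_iso_bij; split=> [|y].
    apply: linear_inj0 => x fx; apply: K0; last exact: iT.
    by rewrite iterSr fx; apply: (linear0 (fn _)).
  by have [x _ ->] := iT y; exists (iter (maxn n m) f x).
Qed.

(** With [u] inverse to [h], Fitting's lemma leaves the case of nilpotent u f and u g with sum 1.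
    Where u g vanishes u f is the identity, so u g is injective, and being nilpotent it forces [X]
    to be zero. *)
Lemma local_endomorphisms (X : lmodType L) (f g h : {linear X -> X}) :
  dcc X -> acc X -> indecomposable X -> is_iso h ->
  (forall x, h x = f x + g x) -> is_iso f \/ is_iso g.
Proof.
move=> dX aX indX [u [hu uh]] hE.
have iso_of (k : {linear X -> X}) : is_iso (u \o k) -> is_iso k.
  move=> /is_iso_bij[ukI ukS]; apply/is_iso_bij; split=> [x y kxy|y].
    by apply: ukI => /=; rewrite kxy.
  by have [x /= xE] := ukS (u y); exists x; rewrite -[y]uh xE uh.
have [[n fn]|/iso_of] := fitting (u \o f) dX aX indX; last by left.
have [[m gm]|/iso_of] := fitting (u \o g) dX aX indX; last by right.
have fixf x : u (g x) = 0 -> x = 0.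
  move=> gx; have fx : (u \o f) x = x by rewrite -[RHS]hu hE linearD gx addr0.
  by rewrite -[RHS](fn x); elim: (n) => [|k IHk] //; rewrite iterS -IHk; exact: esym fx.
case: indX => X0; case: X0 => x.
by elim: m gm => [/(_ x)//|m IHm] gm; apply: IHm => y; apply: fixf; apply: gm.
Qed.

End Indecomposables.

(** * Left almost split maps *)

Section DualGenerators.
Variable R : comPzRingType.
Hypothesis artR : artinian R.
Variable J : lmodType R.
Hypotheses (sdJ : socle_distinct J) (fgJ : finitely_generated J) (faithJ : faithful J).

Lemma sum_is_linear (V W : lmodType R) b (r : 'I_b -> R) (y : 'I_b -> {linear V -> W}) :
  linear (fun x => \sum_i r i *: y i x).
Proof.
move=> a u v; rewrite scaler_sumr -big_split /=; apply: eq_bigr => i _.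
by rewrite linearP scalerDr scaler_swap.
Qed.

(** A finite family with minimal common kernel separates points by [cogenerator]; then it generates
    by [double_annihilator]. *)
Lemma dual_generators (V : lmodType R) : finitely_generated V ->
  exists b (y : 'I_b -> {linear V -> J}),
    (forall x, (forall i, y i x = 0) -> x = 0) /\
    forall f : {linear V -> J}, exists r : 'I_b -> R, forall x, f x = \sum_i r i *: y i x.
Proof.
move=> fgV; have dV := dcc_fgen artR fgV.
pose P (K : V -> Prop) := exists b (y : 'I_b -> {linear V -> J}),
  forall x, K x <-> forall i, y i x = 0.
have [|K [sK [b [y yK]] Kmin]] := @dcc_min _ V P dV.
  exists (fun=> True); first exact: submod_true.
  by exists 0%N, (fun=> \0) => x; split=> // _ [].
have y0 x : (forall i, y i x = 0) -> x = 0.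
  move=> /yK Kx; apply: contrapT => x0.
  have [f _ fx] := cogenerator artR sdJ fgJ faithJ fgV (submod_zero V) x0.
  suff : incl K (fun z => K z /\ f z = 0) by case/(_ x Kx) => _ /fx.
  apply: Kmin; last by move=> z [].
    by apply: submodI => //; apply: submod_ker.
  exists b.+1, (fun i => oapp y f (unlift ord0 i)) => z; split=> [[/yK Kz fz] i|yz].
    by case: unliftP => [j _|_]; first exact: Kz.
  split; last by have := yz ord0; rewrite unlift_none.
  by apply/yK => i; have := yz (lift ord0 i); rewrite liftK.
exists b, y; split=> // f.
have [||||w [r rE] fE] := @double_annihilator R artR J sdJ V (fun=> True)
  (fun w => exists r : 'I_b -> R, forall x, w x = \sum_i r i *: y i x) f dV.
- exact: submod_true.
- split=> [w [r rE] a u v _ _||w w' a [r rE] [r' r'E]].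
  + by rewrite !rE sum_is_linear.
  + by exists (fun=> 0) => x; rewrite big1 // => i _; rewrite scale0r.
  + exists (fun i => r i + a * r' i) => x; rewrite rE r'E scaler_sumr -big_split /=.
    by apply: eq_bigr => i _; rewrite scalerDl scalerA.
- by move=> a u v _ _; rewrite linearP.
- move=> x _ kx; rewrite [x]y0 ?linear0 // => i; apply: (kx (y i)).
  exists (fun j => (j == i)%:R) => z; rewrite (bigD1 i) //= eqxx scale1r big1 ?addr0 //.
  by move=> j /negPf ->; rewrite scale0r.
by exists r => x; rewrite fE // rE.
Qed.

(** This is [double_annihilator] on R^b, applied to the functional with coefficients [c] and the
    space of functionals given by the points of [V]. *)
Lemma dual_system_solvable (V : lmodType R) b (y : 'I_b -> {linear V -> J}) (c : 'I_b -> J) :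
  (forall r : 'I_b -> R, (forall x, \sum_i r i *: y i x = 0) -> \sum_i r i *: c i = 0) ->
  exists x, forall i, c i = y i x.
Proof.
move=> cy; pose F : lmodType R := {ffun 'I_b -> R^o}.
have fgF : finitely_generated F.
  exact/finitely_generated_ffun/finitely_generated_regular.
have lsum (d : 'I_b -> J) a (u v : F) :
    \sum_i (a *: u + v) i *: d i = a *: (\sum_i u i *: d i) + \sum_i v i *: d i.
  rewrite scaler_sumr -big_split /=; apply: eq_bigr => i _.
  by rewrite !ffunE scalerDl -scalerA.
have [||||w [x wE] cE] := @double_annihilator R artR J sdJ F (fun=> True)
  (fun w => exists x, forall r, w r = \sum_i r i *: y i x)
  (fun r => \sum_i r i *: c i) (dcc_fgen artR fgF).
- exact: submod_true.
- split=> [w [x wE] a u v _ _||w w' a [x wE] [x' w'E]].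
  + by rewrite !wE lsum.
  + by exists 0 => r; rewrite big1 // => i _; rewrite linear0 scaler0.
  + exists (x + a *: x') => r; rewrite wE w'E scaler_sumr -big_split /=.
    apply: eq_bigr => i _; rewrite linearD scalerDr; congr (_ + _).
    by rewrite linearZ_LR; exact: scaler_swap.
- by move=> a u v _ _; rewrite lsum.
- move=> r _ kr; apply: cy => x.
  by apply: (kr (fun s : F => \sum_i s i *: y i x)); exists x.
exists x => i.
have E (d : 'I_b -> J) : \sum_j (fdelta i (1 : R^o)) j *: d j = d i.
  rewrite (bigD1 i) //= ffunE eqxx scale1r big1 ?addr0 // => j /negPf ji.
  by rewrite ffunE ji scale0r.
by rewrite -(E c) cE // wE E.
Qed.

End DualGenerators.

Section LeftAlmostSplit.
Variables (R : comPzRingType) (L : pzRingType) (phi : {rmorphism R -> L}).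
Hypothesis artL : artin_algebra phi.
Local Notation res := (res_sort phi).

Definition split_mono (X M : lmodType L) (h : {linear X -> M}) : Prop :=
  exists p : {linear M -> X}, forall x, p (h x) = x.

Section Given.
Variables (J : lmodType R) (X : lmodType L).
Hypotheses (sdJ : socle_distinct J) (fgJ : finitely_generated J) (faithJ : faithful J).
Hypotheses (fgX : finitely_generated X) (indX : indecomposable X).
Variables (b : nat) (y : 'I_b -> {linear res X -> J}).
Hypothesis y_sep : forall x, (forall i, y i x = 0) -> x = 0.
Hypothesis y_gen : forall f : {linear res X -> J},
  exists r : 'I_b -> R, forall x, f x = \sum_i r i *: y i x.

Let artR : artinian R. Proof. by case: artL. Qed.
Let central (r : R) (l : L) : phi r * l = l * phi r.
Proof. by case: artL => _ + _; apply. Qed.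

(** Relations among the [y i] in the right L-module Hom_R(X, J), where (y l)(x) = y(l x). *)
Definition relation (l : {ffun 'I_b -> L^o}) : Prop :=
  forall x : X, \sum_i y i ((l i : L) *: x) = 0.

Lemma submod_relation : submod (relation : res {ffun 'I_b -> L^o} -> Prop).
Proof.
split=> [x|l l' rl rl' x|r l rl x].
- by rewrite big1 // => i _; rewrite ffunE scale0r linear0.
- transitivity (\sum_i y i ((l i : L) *: x) + \sum_i y i ((l' i : L) *: x)).
    rewrite -big_split; apply: eq_bigr => i _.
    by rewrite ffunE scalerDl linearD.
  by rewrite rl rl' addr0.
- transitivity (r *: \sum_i y i ((l i : L) *: x)); last by rewrite rl scaler0.
  rewrite scaler_sumr; apply: eq_bigr => i _.
  by rewrite res_scaleE ffunE -scalerA -linearZ.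
Qed.

Lemma relations_fgen : exists a (A : 'I_a -> {ffun 'I_b -> L^o}),
  (forall j, relation (A j)) /\
  forall l, relation l -> exists c : 'I_a -> R,
    forall i, l i = \sum_j phi (c j) * A j i.
Proof.
have fgF : finitely_generated (res {ffun 'I_b -> L^o}).
  apply: finitely_generated_res => //.
  exact/finitely_generated_ffun/finitely_generated_regular.
have [a [A [AR AG]]] := acc_fgen (acc_fg artR fgF) submod_relation.
exists a, A; split=> // l /AG[c lE]; exists c => i.
have -> : l = \sum_j (phi (c j) *: (A j : {ffun 'I_b -> L^o})) by exact: lE.
by rewrite sum_ffunE; apply: eq_bigr => j _; rewrite ffunE.
Qed.

Variables (a : nat) (A : 'I_a -> {ffun 'I_b -> L^o}).
Hypothesis A_rel : forall j, relation (A j).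
Hypothesis A_gen : forall l, relation l -> exists c : 'I_a -> R,
  forall i, l i = \sum_j phi (c j) * A j i.

(** The quotient of M^b by the solvable systems is the tensor product of Hom_R(X, J) with [M] over
    [L]. *)
Definition solvable (M : lmodType L) (v : 'I_b -> M) : Prop :=
  exists m : 'I_a -> M, forall i, v i = \sum_j (A j i : L) *: m j.

Lemma submod_solvable (M : lmodType L) :
  submod (fun v : res {ffun 'I_b -> M} => solvable (v : {ffun 'I_b -> M})).
Proof.
split=> [|u v [m mE] [n nE]|r u [m mE]].
- by exists (fun=> 0) => i; rewrite ffunE big1 // => j _; rewrite scaler0.
- exists (fun j => m j + n j) => i; rewrite ffunE mE nE -big_split.
  by apply: eq_bigr => j _; rewrite scalerDr.
- exists (fun j => phi r *: m j) => i; rewrite res_scaleE ffunE mE scaler_sumr.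
  by apply: eq_bigr => j _; rewrite !scalerA central.
Qed.

(* The dual of the functor M |-> M^b / {solvable systems} is Hom(-, X). *)
Lemma solvable_dual (M : lmodType L) (f : {linear res {ffun 'I_b -> M} -> J}) :
  (forall v : {ffun 'I_b -> M}, solvable v -> f v = 0) ->
  exists g : {linear M -> X}, forall v : {ffun 'I_b -> M}, f v = \sum_i y i (g (v i)).
Proof.
move=> f0; pose fi i (m : M) : J := f (fdelta i m : {ffun 'I_b -> M}).
have fE (v : {ffun 'I_b -> M}) : f v = \sum_i fi i (v i).
  by rewrite {1}[v]ffun_sum_fdelta; exact: (linear_sum f).
have fiD i m m' : fi i (m + m') = fi i m + fi i m'.
  rewrite /fi -linearD; congr (f _); apply/ffunP => k; rewrite !ffunE.
  by case: eqP; rewrite ?addr0.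
have fiZ i r m : fi i (phi r *: m) = r *: fi i m.
  rewrite /fi -linearZ; congr (f _); apply/ffunP => k; rewrite !ffunE.
  by case: eqP; rewrite ?scaler0.
have fi_rel (l : {ffun 'I_b -> L^o}) m : relation l -> \sum_i fi i ((l i : L) *: m) = 0.
  move=> /A_gen[c lE].
  have := fE [ffun i => (l i : L) *: m]; rewrite f0.
    by move/esym=> E; rewrite -[RHS]E; apply: eq_bigr => i _; rewrite ffunE.
  exists (fun j => phi (c j) *: m) => i; rewrite ffunE lE scaler_suml.
  by apply: eq_bigr => j _; rewrite central scalerA.
(* By [fi_rel] the values [fi i m] satisfy all R-relations among the [y i], hence are the
   coordinates of an element of [X]. *)
have /choice[g gE] (m : M) : exists x : X, forall i, fi i m = y i x.
  apply: (@dual_system_solvable R artR J sdJ (res X) b y (fi^~ m)) => r ry.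
  have rr : relation [ffun i => phi (r i) : L^o].
    by move=> x; rewrite -[RHS](ry x); apply: eq_bigr => i _; rewrite ffunE -linearZ.
  rewrite -[RHS](fi_rel _ m rr); apply: eq_bigr => i _.
  by rewrite ffunE fiZ.
have lg : linear g.
  move=> l m m'; apply/eqP; rewrite -subr_eq0; apply/eqP/y_sep => i.
  rewrite linearB /= linearD -!gE fiD opprD addrACA subrr addr0.
  have lyl : linear (fun x : res X => y i (l *: (x : X)) : J).
    move=> r x x'; rewrite -linearP; congr (y i _).
    by rewrite !res_scaleE scalerDr !scalerA central.
  (* Expressing x |-> y_i(l x) through the [y k] gives a relation, which [fi_rel] transports to the
     [fi]. *)
  have [r rE] := y_gen (mklin lyl).
  have lrel : relation [ffun k => (if k == i then l else 0) - phi (r k) : L^o].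
    move=> x; under eq_bigr => k _ do rewrite ffunE scalerBl linearB /=.
    rewrite sumrB (bigD1 i) //= eqxx big1 ?addr0; last first.
      by move=> k /negPf ->; rewrite scale0r linear0.
    rewrite -[y i _]/(mklin lyl x) rE -sumrB big1 // => k _.
    by rewrite -linearZ subrr.
  have fil : fi i (l *: m) = \sum_k r k *: fi k m.
    apply: subr0_eq; rewrite -[RHS](fi_rel _ m lrel).
    under [RHS]eq_bigr => k _ do
      rewrite ffunE scalerBl fiD -scaleN1r scalerA -(rmorphN1 phi) -rmorphM fiZ mulN1r scaleNr.
    rewrite [RHS]sumrB [X in _ = X - _](bigD1 i) //= eqxx [X in _ = _ + X - _]big1 ?addr0 //.
    by move=> k /negPf ->; rewrite scale0r -[0](scale0r (0 : M)) -(rmorph0 phi) fiZ scale0r.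
  rewrite fil -[y i _]/(mklin lyl (g m)) rE; apply/eqP; rewrite subr_eq0; apply/eqP.
  by apply: eq_bigr => k _; rewrite gE.
by exists (mklin lg) => v; rewrite fE; apply: eq_bigr => i _; rewrite gE.
Qed.

(** The functionals of non-isomorphisms [f] form a function space because End(X) is local. Without
    such a [t] it would contain the functional of the identity, and [y_sep] would make some
    non-isomorphism the identity. *)
Lemma test_vector : exists t : {ffun 'I_b -> X},
  (forall f : {linear X -> X}, ~ is_iso f -> \sum_i y i (f (t i)) = 0) /\
  \sum_i y i (t i) <> 0.
Proof.
apply: contrapT => nt; pose V := {ffun 'I_b -> X}.
have fgV : finitely_generated (res V).
  exact/finitely_generated_res/finitely_generated_ffun.
have lsum (f : {linear X -> X}) :
    lin_on (fun=> True) (fun v : res V => \sum_i y i (f ((v : V) i))).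
  move=> r u v _ _; rewrite scaler_sumr -big_split /=; apply: eq_bigr => i _.
  by rewrite res_scaleE !ffunE linearP; exact: (linearP (y i)).
have isoN0 (f : {linear X -> X}) : is_iso f -> exists x, f x <> 0.
  case=> g [fg _]; apply: contrapT => f0; case: indX => X0; case: X0 => x.
  rewrite -(fg x) [f x](_ : _ = 0) ?linear0 //.
  by apply: contrapT => fx; apply: f0; exists x.
have [||||w [f nf wE] fE] := @double_annihilator R artR J sdJ (res V) (fun=> True)
  (fun w => exists2 f : {linear X -> X}, ~ is_iso f &
     forall v : V, w v = \sum_i y i (f (v i)))
  (fun v : res V => \sum_i y i ((v : V) i)) (dcc_fgen artR fgV).
- exact: submod_true.
- split=> [w [f nf wE] r u v _ _||w w' r [f nf wE] [g ng w'E]].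
  + by rewrite !wE lsum.
  + exists \0 => [/isoN0[x []] //|v].
    by rewrite big1 // => i _; rewrite linear0.
  + have lg : linear (fun x => phi r *: g x).
      by move=> l u v; rewrite linearP scalerDr !scalerA central.
    have lh : linear (fun x => f x + phi r *: g x).
      by move=> l u v; rewrite -[phi r *: g _]/(mklin lg _) !linearP scalerDr addrACA.
    exists (mklin lh) => [ih|v].
      have [//|/is_iso_bij[gI gS]] := local_endomorphisms (f := f) (g := mklin lg)
        (artin_dcc artL fgX) (artin_acc artL fgX) indX ih (fun=> erefl).
      apply: ng; apply/is_iso_bij; split=> [u v guv|u]; first by apply: gI; rewrite !mklinE guv.
      by have [x ->] := gS u; exists (phi r *: x); rewrite linearZ.
    rewrite wE w'E scaler_sumr -big_split; apply: eq_bigr => i _.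
    by rewrite mklinE linearD -linearZ.
- by move=> r u v _ _; exact: (lsum idfun).
- move=> v _ kv; apply: contrapT => v0; apply: nt; exists v; split=> // f nf.
  by apply: (kv (fun v : res V => \sum_i y i (f ((v : V) i)))); exists f.
apply: nf; apply/is_iso_bij; suff fid x : f x = x by split=> [u v|u]; [rewrite !fid | exists u].
apply/eqP; rewrite -subr_eq0; apply/eqP/y_sep => i; rewrite linearB /=.
have E (g : {linear X -> X}) : \sum_k y k (g (fdelta i x k)) = y i (g x).
  rewrite (bigD1 i) //= ffunE eqxx big1 ?addr0 // => k /negPf ki.
  by rewrite ffunE ki !linear0.
by rewrite -(E f) -wE -fE // (E idfun) subrr.
Qed.

Variable t : {ffun 'I_b -> X}.
Hypothesis t_rad : forall f : {linear X -> X}, ~ is_iso f -> \sum_i y i (f (t i)) = 0.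
Hypothesis t_neq0 : \sum_i y i (t i) <> 0.

(** A functional separating h(t) from the solvable systems comes from some g : M -> X; by [t_rad], g
    h is then an isomorphism and [h] splits. *)
Lemma solvable_nonsplit (M : lmodType L) (h : {linear X -> M}) :
  finitely_generated M -> ~ split_mono h -> solvable (fun i => h (t i)).
Proof.
move=> fgM nh; apply: contrapT => nsol.
have fgV : finitely_generated (res {ffun 'I_b -> M}).
  exact/finitely_generated_res/finitely_generated_ffun.
have [|f fN] := @cogenerator R artR J sdJ fgJ faithJ (res {ffun 'I_b -> M}) _
    ([ffun i => h (t i)] : {ffun 'I_b -> M}) fgV (submod_solvable M).
  by move=> [m mE]; apply: nsol; exists m => i; rewrite -mE ffunE.
have [g gE] := solvable_dual fN; rewrite gE.
under eq_bigr => i _ do rewrite ffunE.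
apply; apply: (t_rad (f := g \o h)) => -[u [ghu _]].
by apply: nh; exists (u \o g) => x; exact: ghu.
Qed.

(** [E] is the quotient of X x L^a by the elements [rel_elt i], which adjoins a universal solution
    of t = A z. A retraction of [e] would solve the system in [X], and [A_rel] would contradict
    [t_neq0]. *)
Lemma left_almost_split_extension : exists (E : lmodType L) (e : {linear X -> E}),
  [/\ finitely_generated E, ~ split_mono e &
      forall (M : lmodType L) (h : {linear X -> M}), finitely_generated M ->
        ~ split_mono h -> exists g : {linear E -> M}, forall x, h x = g (e x)].
Proof.
pose F : lmodType L := {ffun 'I_a -> L^o}.
pose V : lmodType L := (X * F)%type.
have fgV : finitely_generated V.
  apply: finitely_generated_prod => //.
  exact/finitely_generated_ffun/finitely_generated_regular.
pose rel_elt i : V := (t i, - [ffun j => (A j i : L^o)]).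
pose K (v : V) := exists c : 'I_b -> L, v = \sum_i c i *: rel_elt i.
have sK : submod K.
  split=> [|_ _ [c ->] [d ->]|l _ [c ->]].
  - by exists (fun=> 0); rewrite big1 // => i _; rewrite scale0r.
  - exists (fun i => c i + d i); rewrite -big_split; apply: eq_bigr => i _.
    exact: esym (scalerDl _ _ _).
  - exists (fun i => l * c i); rewrite scaler_sumr; apply: eq_bigr => i _.
    by rewrite scalerA.
have [E [p [pS pK]]] := quotient_exists sK.
have lin1 : linear (fun x : X => p (x, 0)).
  move=> l u v; rewrite -linearP; congr (p _).
  by rewrite -[RHS]/(l *: u + v, l *: 0 + 0) scaler0 addr0.
have p_rel i : p (t i, 0) = p (0, [ffun j => (A j i : L^o)]).
  apply: subr0_eq; rewrite -linearB; apply/pK; exists (fun k => (k == i)%:R).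
  rewrite (bigD1 i) //= eqxx scale1r big1 ?addr0.
    by rewrite -[LHS]/(t i - 0, 0 - _) subr0 sub0r.
  by move=> k /negPf ->; rewrite scale0r.
exists E, (mklin lin1); split; first exact: finitely_generated_img fgV.
- case=> q qE; apply: t_neq0.
  have lq : linear (fun z : F => q (p (0, z))).
    move=> l u v; rewrite -!linearP; congr (q (p _)).
    by rewrite -[RHS]/(l *: 0 + 0, l *: u + v) scaler0 addr0.
  pose x j : X := q (p (0, fdelta j (1 : L^o))).
  have tE i : t i = \sum_j (A j i : L) *: x j.
    rewrite -[LHS]qE mklinE p_rel -[LHS]/(mklin lq [ffun j => (A j i : L^o)]).
    rewrite [X in mklin lq X]ffun_sum_fdelta linear_sum.
    apply: eq_bigr => j _; rewrite -[x j]/(mklin lq (fdelta j (1 : L^o))) -linearZ.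
    congr (mklin lq _).
    apply/ffunP => k; rewrite !ffunE; case: eqP => _; rewrite ?scaler0 //.
    exact: esym (mulr1 _).
  under eq_bigr => i _ do rewrite tE linear_sum.
  by rewrite exchange_big big1 // => j _; exact: A_rel.
- move=> M h fgM /(solvable_nonsplit fgM)[m mE].
  have lg : linear (fun v : V => h v.1 + \sum_j (v.2 j : L) *: m j).
    move=> l u v; rewrite linearP scalerDr addrACA; congr (_ + _).
    rewrite scaler_sumr -big_split; apply: eq_bigr => j _.
    by rewrite !ffunE scalerDl scalerA.
  have [v /pK[c ->]|g gE] := linear_descends (f := mklin lg) pS.
    rewrite linear_sum big1 // => i _; rewrite linearZ mklinE /= (mE i) -big_split /=.
    by rewrite big1 ?scaler0 // => j _; rewrite !ffunE scaleNr subrr.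
  exists g => x; rewrite gE mklinE /= big1 ?addr0 // => j _.
  by rewrite ffunE scale0r.
Qed.

End Given.

Lemma left_almost_split (X : lmodType L) : finitely_generated X -> indecomposable X ->
  exists (E : lmodType L) (e : {linear X -> E}),
  [/\ finitely_generated E, ~ split_mono e &
      forall (M : lmodType L) (h : {linear X -> M}), finitely_generated M ->
        ~ split_mono h -> exists g : {linear E -> M}, forall x, h x = g (e x)].
Proof.
move=> fgX indX; have [artR _ _] := artL.
have [J [fgJ sdJ faithJ]] := injective_cogenerator_exists artR.
have [b [y [y_sep y_gen]]] :=
  dual_generators artR sdJ fgJ faithJ (finitely_generated_res artL fgX).
have [a [A [A_rel A_gen]]] := relations_fgen y.
have [t [t_rad t_neq0]] := test_vector sdJ fgX indX y_sep.
exact: (left_almost_split_extension sdJ fgJ faithJ fgX y_sep y_gen A_rel A_gen t_rad t_neq0).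
Qed.

End LeftAlmostSplit.

(** * Big elements *)

Section FiniteClasses.
Variable L : pzRingType.

Definition iso_finite (P : lmodType L -> Prop) : Prop :=
  exists n (X : 'I_n -> lmodType L), forall M, P M -> exists i, isomorphic M (X i).

Lemma iso_finiteW (P Q : lmodType L -> Prop) :
  (forall M, P M -> Q M) -> iso_finite Q -> iso_finite P.
Proof. by move=> PQ [n [X XQ]]; exists n, X => M /PQ/XQ. Qed.

Lemma iso_finiteU (P Q : lmodType L -> Prop) :
  iso_finite P -> iso_finite Q -> iso_finite (fun M => P M \/ Q M).
Proof.
move=> [n [X PX]] [m [Y QY]].
exists (n + m)%N, (fun i => match split i with inl j => X j | inr k => Y k end).
move=> M [/PX[i Mi]|/QY[i Mi]].
  by exists (unsplit (inl i)); rewrite unsplitK.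
by exists (unsplit (inr i)); rewrite unsplitK.
Qed.

Lemma iso_finite1 (X : lmodType L) : iso_finite (fun M => isomorphic M X).
Proof. by exists 1%N, (fun=> X) => M MX; exists ord0. Qed.

(* M is isomorphic to X x M/h(X). *)
Lemma split_mono_iso (X M : lmodType L) (h : {linear X -> M}) :
  ~ is_zero_module X -> indecomposable M -> split_mono h -> isomorphic M X.
Proof.
move=> X0 [_ indM] [p ph].
have sh : submod (img h (fun=> True)) by apply: submod_img.
have [Q [q [qS qK]]] := quotient_exists sh.
have lf : linear (fun m => (p m, q m)) by move=> a x y; rewrite !linearP.
have qh x : q (h x) = 0 by apply/qK; exists x.
have : isomorphic M (X * Q)%type.
  exists (mklin lf); apply/is_iso_bij; split.
    apply: linear_inj0 => m [pm /qK[x _ mE]].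
    by rewrite mE -[x]ph -mE pm linear0.
  move=> [x r]; have [m ->] := qS r; exists (h (x - p m) + m).
  by rewrite mklinE (linearD p) (linearD q) ph qh subrK add0r.
case/indM=> // Q0; exists p; apply/is_iso_bij; split=> [|x]; last by exists (h x).
apply: linear_inj0 => m pm; have /qK[x _ mE] := Q0 (q m).
by rewrite mE -[x]ph -mE pm linear0.
Qed.

End FiniteClasses.

Section Targets.
Variables (R : comPzRingType) (L : pzRingType) (phi : {rmorphism R -> L}).
Hypothesis artL : artin_algebra phi.
Variable C : lmodType L -> Prop.
Hypotheses (fgC : subcategory_of_mod C) (sumC : summand_closed C).
Hypothesis ffC : functorially_finite C.

Definition target_of (X : lmodType L) (x : X) (M : lmodType L) : Prop :=
  [/\ C M, indecomposable M & exists g : {linear X -> M}, g x <> 0].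

Definition big (X : lmodType L) (x : X) : Prop := ~ iso_finite (target_of x).

Lemma big_neq0 (X : lmodType L) (x : X) : big x -> x <> 0.
Proof.
move=> bx x0; apply: bx; exists 0%N, (fun=> X) => M [_ _ [g]].
by rewrite x0 linear0.
Qed.

(* Take a direct summand of B with minimal image among those in which the
   component of b is big: splitting it further would leave one of the two
   components big. *)
Lemma big_indecomposable_summand (B : lmodType L) (b : B) : C B -> big b ->
  exists (Y : lmodType L) (i : {linear Y -> B}) (p : {linear B -> Y}),
    [/\ C Y, indecomposable Y, forall y, p (i y) = y & big (p b)].
Proof.
move=> CB bb; have dB := artin_dcc artL (fgC CB).
(* Summands are compared through their images in [B], where the descending chain condition
   applies. *)
pose P (K : B -> Prop) := exists (Y : lmodType L) (i : {linear Y -> B}) (p : {linear B -> Y}),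
  [/\ C Y, forall y, p (i y) = y, big (p b) & forall z, K z <-> img i (fun=> True) z].
have [|K [sK [Y [i [p [CY pi bp KE]]]] Kmin]] := @dcc_min _ B P dB.
  exists (fun=> True); first exact: submod_true.
  by exists B, idfun, idfun; split=> // z; split=> // _; exists z.
exists Y, i, p; split=> //; split.
  by move=> Y0; apply: (big_neq0 bp).
(* If the component in [U] is big, minimality makes the image of [U] in [B] all of [K], which leaves
   no room for [V]. *)
have side (U V : lmodType L) (j : {linear U -> Y}) (q : {linear Y -> U}) (v : {linear V -> Y}) :
    C U -> (forall u, q (j u) = u) -> (forall z, q (v z) = 0) -> injective v ->
    big (q (p b)) -> is_zero_module V.
  move=> CU qj qv vI bq z; apply: vI; rewrite linear0.
  pose K' := img (i \o j) (fun=> True).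
  have K'K : incl K K'.
    apply: Kmin; first exact: submod_img.
      exists U, (i \o j), (q \o p).
      by split=> // u /=; rewrite pi.
    by move=> _ [u _ ->]; apply/KE; exists (j u).
  have [|u _ /= E] := K'K (i (v z)); first by apply/KE; exists (v z).
  have vz : v z = j u by rewrite -[LHS]pi E pi.
  by rewrite vz -[u]qj -vz qv linear0.
move=> U V [f [g [fg gf]]].
have [CU CV] := sumC (ex_intro _ f (ex_intro _ g (conj fg gf))) CY.
have lj : linear (fun u : U => g (u, 0)).
  by move=> a x y; rewrite -linearP; congr (g _); rewrite -[RHS]/(_, a *: 0 + 0) scaler0 addr0.
have lv : linear (fun v : V => g (0, v)).
  by move=> a x y; rewrite -linearP; congr (g _); rewrite -[RHS]/(a *: 0 + 0, _) scaler0 addr0.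
have lq : linear (fun y => (f y).1) by move=> a x y; rewrite linearP.
have lr : linear (fun y => (f y).2) by move=> a x y; rewrite linearP.
pose j := mklin lj; pose v := mklin lv; pose q := mklin lq; pose r := mklin lr.
have gI : injective g := can_inj gf.
have decomp y : y = j (q y) + v (r y).
  rewrite -[LHS]fg -[RHS]/(g ((f y).1, 0) + g (0, (f y).2)) -linearD.
  congr (g _); case: (f y) => s t.
  by rewrite -[RHS]/(s + 0, 0 + t) addr0 add0r.
have [bq|sq] := pselect (big (q (p b))).
  right; apply: (side U V j q v) => // [u|z|z z'].
  - by rewrite !mklinE gf.
  - by rewrite !mklinE gf.
  - by rewrite !mklinE => /gI[].
left; apply: (side V U v r j) => // [u|z|z z'|].
- by rewrite !mklinE gf.
- by rewrite !mklinE gf.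
- by rewrite !mklinE => /gI[].
(* A map not killing [p b] is nonzero on one of its two components, so they cannot both fail to be
   big. *)
move=> sr; apply: bp; move/contrapT: sq => sq.
apply: iso_finiteW (iso_finiteU sq sr) => M [CM indM [h hp]].
have [hq|hq] := pselect (h (j (q (p b))) = 0); [right | left]; split=> //.
  by exists (h \o v) => /= hr; apply: hp; rewrite [p b]decomp linearD hq hr addr0.
by exists (h \o j).
Qed.

(** Any nonzero element of a module is the image of 1 under a map from [L], so every indecomposable
    of [C] is a target of [al 1]. *)
Lemma big_start : ~ finite_representation_type C ->
  exists (X : lmodType L) (x : X), [/\ C X, indecomposable X & big x].
Proof.
move=> nfin; have [[A [al [CA alP]]] _] := ffC (finitely_generated_regular L).
have [|Y [_ [p [CY indY _ bY]]]] := @big_indecomposable_summand A (al 1) CA.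
  case=> n [Z ZP]; apply: nfin; exists n, Z => M CM indM; apply: ZP; split=> //.
  have [m m0] : exists m : M, m <> 0.
    apply: contrapT => nm; case: indM => M0 _; apply: M0 => m; apply: contrapT => m0.
    by apply: nm; exists m.
  have lm : linear (fun a : L^o => (a : L) *: m).
    by move=> a u v; rewrite scalerDl scalerA.
  have [h hE] := alP M (mklin lm) CM; exists h.
  by rewrite -[h _]/((h \o al) 1) -hE mklinE scale1r.
by exists Y, (p (al 1)).
Qed.

Lemma big_step (X : lmodType L) (x : X) : C X -> indecomposable X -> big x ->
  exists (Y : lmodType L) (h : {linear X -> Y}),
    [/\ C Y, indecomposable Y, ~ is_iso h & big (h x)].
Proof.
move=> CX indX bx.
have [E [e [fgE ne eP]]] := left_almost_split artL (fgC CX) indX.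
have [[B [be [CB beP]]] _] := ffC fgE.
have [|Y [i [p [CY indY pi bY]]]] := @big_indecomposable_summand B (be (e x)) CB.
  (* Only the class of [X] can be lost in passing from the targets of [x] to those of [be (e x)]. *)
  move=> fin; apply: bx; apply: iso_finiteW (iso_finiteU (iso_finite1 X) fin).
  move=> M [CM indM [g gx]].
  have [MX|nMX] := pselect (isomorphic M X); [by left | right; split=> //].
  have [|g' g'E] := eP M g (fgC CM).
    by apply/(contra_not _ nMX)/split_mono_iso => //; case: indX.
  have [g'' g''E] := beP M g' CM.
  by exists g''; rewrite -[g'' _]/((g'' \o be) (e x)) -g''E -g'E.
(* An inverse of the composite would give a retraction of [e]. *)
exists Y, (p \o (be \o e)); split=> // -[u [hu _]]; apply: ne.
by exists (u \o (p \o be)) => z; exact: hu.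
Qed.

End Targets.

(** * The infinite chain of non-isomorphisms *)

Theorem proposition3p13 (R : comPzRingType) (L : pzRingType)
  (phi : {rmorphism R -> L}) (C : lmodType L -> Prop) :
  artin_algebra phi ->
  subcategory_of_mod C ->
  additive_subcategory C ->
  summand_closed C ->
  iso_closed C ->
  functorially_finite C ->
  (forall (J : Type) (f : J -> morphism L),
     (forall j, between_indecomposables C (f j)) -> noetherian f) ->
  finite_representation_type C.
Proof.
move=> artL fgC _ sumC _ ffC noethC; apply: contrapT => nfin.
pose state := {X : lmodType L & X}.
pose st (X : lmodType L) (x : X) : state := existT _ X x.
pose good (s : state) := [/\ C (tag s), indecomposable (tag s) & big C (tagged s)].
pose step (s s' : state) := exists h : {linear tag s -> tag s'},
  ~ is_iso h /\ h (tagged s) = tagged s'.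
have [X0 [x0 [CX0 indX0 bx0]]] := big_start artL fgC sumC ffC nfin.
have next s : good s -> exists2 s', good s' & step s s'.
  case: s => X x [CX indX bx].
  have [Y [h [CY indY nh bh]]] := big_step artL fgC sumC ffC CX indX bx.
  by exists (st Y (h x)) => //; exists h.
have good0 : good (st X0 x0) by [].
have [s [_ sgood sstep]] := dependent_choice good0 next.
have [g gP] : exists g : forall n, {linear tag (s n) -> tag (s n.+1)},
    forall n, ~ is_iso (g n) /\ g n (tagged (s n)) = tagged (s n.+1).
  by exists (fun n => sval (cid (sstep n))) => n; case: (cid (sstep n)).
(* The composites carry the initial element to big elements, which are nonzero. *)
have comp_s n : chain_comp g n (tagged (s 0%N)) = tagged (s n).
  by elim: n => //= n IHn; rewrite IHn; case: (gP n).
have [||d dP] := noethC nat (fun n => Morphism (g n)) _ (fun n => tag (s n)) g id (fun=> erefl).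
- by move=> n; case: (sgood n) (sgood n.+1) => ? ? _ [].
- move=> n /(_ (tagged (s 0%N))); rewrite comp_s.
  by case: (sgood n.+1) => _ _ /big_neq0.
- by case: (gP d) => nd _; apply/nd/dP.
Qed.
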